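(* Let $E$, $F$, $X$, and $Z$ be locally convex spaces, $A\subseteq Z$ and $R\subseteq X$ be regular subsets, and $S\subseteq E$ be a locally convex, regular subset. Assume that $k,\ell\in\mathbb{N}_0\cup\{\infty\}$. Let $\gamma\colon A\to C^{\ell+k}(S,F)$ and $\eta\colon A\to C^\ell(R,E)$ be $C^k$-maps such that $\eta(z)(R)\subseteq S$ for all $z\in A$. If $R\times X$ and $A\times Z$ are $k_{\mathbb{R}}$-spaces, then $$\zeta\colon A\to C^\ell(R,F),\quad z\mapsto\gamma(z)\circ\eta(z)$$ is a $C^k$-map.
   Context: ''Locally convex space'' means a real, Hausdorff locally convex topological vector space. A subset $R$ of a topological space is regular if its interior $R^0$ is dense in $R$. A subset $S$ of a locally convex space is called locally convex if each point of $S$ has a neighbourhood in $S$ which is a convex set. For locally convex spaces $X,Y$ and a regular subset $R\subseteq X$, a map $f\colon R\to Y$ is $C^\ell$ if it is continuous and for all $j\in\mathbb{N}$ with $j\le\ell$ the iterated directional derivatives $d^{(j)}f(x,y_1,\ldots,y_j)=(D_{y_j}\cdots D_{y_1}f)(x)$ exist for all $x\in R^0$, $y_1,\ldots,y_j\in X$, and the function so obtained extends to a continuous map $d^{(j)}f\colon R\times X^j\to Y$; $d^{(0)}f:=f$. The space $C^\ell(R,Y)$ of such maps is endowed with the compact-open $C^\ell$-topology: the initial topology with respect to the maps $f\mapsto d^{(j)}f\in C(R\times X^j,Y)$, $0\le j\le\ell$ ($j$ finite), where the spaces of continuous functions carry the compact-open topology; this makes $C^\ell(R,Y)$ a locally convex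 space. A Hausdorff topological space is a $k_{\mathbb{R}}$-space if a real-valued function on it is continuous whenever its restriction to each compact subset is continuous. *)

(* Defs.v *)
From HB Require Import structures.
From mathcomp Require Import all_boot all_order all_algebra.
From mathcomp Require Import all_classical all_reals all_analysis.

Set Implicit Arguments.
Unset Strict Implicit.
Unset Printing Implicit Defensive.

Import Order.TTheory GRing.Theory Num.Theory.
Import numFieldNormedType.Exports.

Local Open Scope classical_set_scope.
Local Open Scope ring_scope.

HB.mixin Record Tvs_isHausdorff (K : realType) E of Tvs K E := {
  lcs_hausdorff : hausdorff_space E
}.

#[short(type="lcsType")]
HB.structure Definition LocallyConvexSpace (K : realType) :=
  {E of Tvs_isHausdorff K E & Tvs K E}.

Definition regular_subset (T : topologicalType) (R : set T) : Prop :=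
  R `<=` closure R°.

(* [within S (nbhs x)] is the filter of (traces of) neighbourhoods of [x] in
   the subspace [S]. *)
Definition locally_convex_subset (K : realType) (E : lcsType K) (S : set E) :
    Prop :=
  forall x, S x ->
    exists U : set E, [/\ within S (nbhs x) U, U `<=` S & convex_set U].

Definition kR_space (K : realType) (T : topologicalType) : Prop :=
  hausdorff_space T /\
  forall f : T -> K,
    (forall C : set T, compact C -> {within C, continuous f}) -> continuous f.

(* [Some n] is the order n, [None] is infinity. *)
Definition smoothness : Type := option nat.

Definition le_smooth (j : nat) (l : smoothness) : bool :=
  if l is Some n then (j <= n)%N else true.

Definition add_smooth (l k : smoothness) : smoothness :=
  match l, k with
  | Some m, Some n => Some (m + n)%N
  | _, _ => None
  end.

(* The codomain [Y] is a module with a topology, without compatibility axioms,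
   so that the definitions apply to [Y] = C^l(R, F) before it is known to be a
   topological vector space. *)
Section directional_derivatives.
Context {K : realType} {X : lcsType K} {Y : preTopologicalLmodType K}.

Definition has_dderiv (f : X -> Y) (x v : X) (d : Y) : Prop :=
  (fun h : K => h^-1 *: (f (x + h *: v) - f x)) @ 0^' --> d.

(* The value is a default one when the limit does not exist. *)
Definition dderiv (v : X) (f : X -> Y) (x : X) : Y :=
  xget 0 (has_dderiv f x v).

(* [iter_dderiv [:: y_1; ...; y_j] f] is D_(y_j) ... D_(y_1) f. *)
Definition iter_dderiv (ys : seq X) (f : X -> Y) : X -> Y :=
  foldl (fun g y => dderiv y g) f ys.

End directional_derivatives.

Section linearity.
Context {K : realType} {X Y : lcsType K}.
Implicit Types (f g : X -> Y) (U : set X).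

Lemma has_dderiv_unique f x v d d' :
  has_dderiv f x v d -> has_dderiv f x v d' -> d = d'.
Proof. exact: (cvg_unique (@lcs_hausdorff K Y)). Qed.

Lemma dderivP f x v d : has_dderiv f x v d -> dderiv v f x = d.
Proof. by move=> fd; apply: xget_unique => // d' /has_dderiv_unique; exact. Qed.

Lemma cvg_add (T : Type) (F : set_system T) (FF : Filter F) (u w : T -> Y) a b :
  u @ F --> a -> w @ F --> b -> (fun t => u t + w t) @ F --> a + b.
Proof.
move=> ua wb; exact: (cvg_comp2 ua wb (@add_continuous Y (a, b))).
Qed.

Lemma cvg_scale (T : Type) (F : set_system T) (FF : Filter F) (c : K)
    (u : T -> Y) a : u @ F --> a -> (fun t => c *: u t) @ F --> c *: a.
Proof.
move=> ua; have cc : (fun=> c : K^o) @ F --> (c : K^o) by exact: cvg_cst.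
exact: (cvg_comp2 cc ua (@scale_continuous K Y (c, a))).
Qed.

Lemma near_line U x v : open U -> U x -> \forall h \near (0 : K)^', U (x + h *: v).
Proof.
move=> oU Ux; apply: nbhs_dnbhs.
have h0 : (fun h : K => h : K^o) @ (0 : K) --> (0 : K^o) by exact: cvg_id.
have hv : (fun h : K => h *: v) @ (0 : K) --> (0 : K) *: v.
  have vv : (fun=> v) @ (0 : K) --> v by exact: cvg_cst.
  exact: (cvg_comp2 h0 vv (@scale_continuous K X (0, v))).
have xx : (fun=> x) @ (0 : K) --> x by exact: cvg_cst.
have := cvg_comp2 xx hv (@add_continuous X (x, 0 *: v)).
move=> /(_ _ _ _ U); rewrite /= scale0r addr0; apply.
exact: open_nbhs_nbhs.
Qed.

Lemma has_dderiv_lin U f g k (a : K) x v d d' : open U -> U x ->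
    (forall z, U z -> k z = a *: f z + g z) ->
  has_dderiv f x v d -> has_dderiv g x v d' ->
  has_dderiv k x v (a *: d + d').
Proof.
move=> oU Ux kE fd gd'.
apply: (cvg_trans _ (cvg_add _ (cvg_scale _ (c := a) fd) gd')).
apply: near_eq_cvg.
near=> h; rewrite !kE//; last by near: h; exact: near_line.
rewrite opprD addrACA -scalerBr [in RHS]scalerDr; congr (_ + _).
by rewrite !scalerA mulrC.
Unshelve. all: by end_near. Qed.

Definition iter_derivable U (n : nat) f := forall (ys : seq X) (y : X),
  (size ys < n)%N -> forall x, U x ->
  exists d, has_dderiv (iter_dderiv ys f) x y d.

Lemma iter_dderiv_lin U n f g k (a : K) : open U ->
    (forall z, U z -> k z = a *: f z + g z) ->
    iter_derivable U n f -> iter_derivable U n g ->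
  forall ys, (size ys <= n)%N -> forall x, U x ->
  iter_dderiv ys k x = a *: iter_dderiv ys f x + iter_dderiv ys g x.
Proof.
move=> oU kE df dg; elim/last_ind => [//|ys y IH].
rewrite size_rcons => lt_n x Ux.
have [d fd] := df _ y lt_n _ Ux; have [d' gd'] := dg _ y lt_n _ Ux.
rewrite /iter_dderiv !foldl_rcons -/(iter_dderiv ys k) -/(iter_dderiv ys f).
rewrite -/(iter_dderiv ys g) (dderivP fd) (dderivP gd'); apply: dderivP.
by apply: (has_dderiv_lin oU Ux _ fd gd') => z Uz; apply: IH => //; exact: ltnW.
Qed.

Lemma iter_derivable_lin U n f g k (a : K) : open U ->
    (forall z, U z -> k z = a *: f z + g z) ->
    iter_derivable U n f -> iter_derivable U n g -> iter_derivable U n k.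
Proof.
move=> oU kE df dg ys y lt_n x Ux.
have [d fd] := df _ y lt_n _ Ux; have [d' gd'] := dg _ y lt_n _ Ux.
exists (a *: d + d'); apply: (has_dderiv_lin oU Ux _ fd gd') => z Uz.
by apply: (iter_dderiv_lin oU kE df dg) => //; exact: ltnW.
Qed.

End linearity.

Section differentiability_classes.
Context {K : realType} {X : lcsType K} {Y : preTopologicalLmodType K}.
Variable R : set X.

Local Notation jet_dom j := (R * {ptws 'I_j -> X})%type.

(* A map defined on [R] is extended by 0 to all of [X]; directional derivatives
   are only considered at interior points of [R], where they depend on the
   restriction to the interior alone. *)
Definition djet (f : R -> Y) (j : nat) (x : X) (y : 'I_j -> X) : Y :=
  iter_dderiv (codom y) ('valL_ 0 f) x.

Definition djet_ext (f : R -> Y) (j : nat) (g : jet_dom j -> Y) : Prop :=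
  continuous g /\
  forall (x : R) (y : 'I_j -> X), R° (val x) -> g (x, y) = djet f (val x) y.

Definition isC (l : smoothness) (f : R -> Y) : Prop :=
  continuous f /\
  forall j, le_smooth j l ->
    (forall (ys : seq X) (y : X), size (rcons ys y) = j ->
       forall x, R° x ->
         exists d, has_dderiv (iter_dderiv ys ('valL_ 0 f)) x y d) /\
    (exists g : jet_dom j -> Y, djet_ext f g).

(* The map d^(j) f on R x X^j: the continuous extension is unique when [R] is
   regular and [Y] is Hausdorff. *)
Definition djet_map (f : R -> Y) (j : nat) : jet_dom j -> Y :=
  xget (fun=> 0) (@djet_ext f j).

End differentiability_classes.

Arguments djet_map {K X Y R} f j _.
Section isC_closed.
Context {K : realType} {X Y : lcsType K}.
Variables (R : set X) (l : smoothness).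

Lemma valL_val (f : R -> Y) (x : R) : 'valL_ 0 f (val x) = f x.
Proof. by have := congr1 (@^~ x) (valLK 0 f). Qed.

Lemma valL_lin (f g : R -> Y) (a : K) (x : X) : R x ->
  'valL_ 0 (a *: f + g) x = a *: 'valL_ 0 f x + 'valL_ 0 g x.
Proof.
move=> Rx; pose x' : R := SigSub (mem_set Rx).
by rewrite -[x]/(val x') !valL_val.
Qed.

Lemma isC_iter_derivable (f : R -> Y) (j : nat) : isC l f -> le_smooth j l ->
  iter_derivable R° j ('valL_ 0 f).
Proof.
case=> _ df jl ys y lt_j x Rx.
have il : le_smooth (size ys).+1 l.
  by move: jl; rewrite /le_smooth; case: (l) => // n; exact: leq_trans.
by apply: (df _ il).1 => //; rewrite size_rcons.
Qed.

Definition Cpred : {pred R -> Y} := fun f => `[< isC l f >].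

Lemma has_dderiv0 (x v : X) : has_dderiv (fun=> 0 : Y) x v 0.
Proof.
rewrite /has_dderiv (_ : (fun h : K => _) = (fun=> 0)); first exact: cvg_cst.
by apply/funext => h; rewrite subrr scaler0.
Qed.

Lemma iter_dderiv0 (ys : seq X) : iter_dderiv ys (fun=> 0 : Y) = (fun=> 0).
Proof.
elim: ys => //= y ys; rewrite (_ : dderiv y _ = (fun=> 0))//.
by apply/funext => x; exact: (dderivP (has_dderiv0 x y)).
Qed.

Lemma isC_submod_closed : submod_closed Cpred.
Proof.
split=> [|a f g /asboolP fC /asboolP gC]; apply/asboolP.
  have v0 : 'valL_ 0 (0 : R -> Y) = (fun=> 0).
    by apply/funext => x; rewrite /valL_ /=; case: ('oinv_set_val x).
  split=> [|j _]; first exact: cst_continuous.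
  split=> [ys y _ x _|].
    by rewrite v0 iter_dderiv0; exists 0; exact: has_dderiv0.
  exists (fun=> 0); split; first exact: cst_continuous.
  by move=> x y _; rewrite /djet v0 iter_dderiv0.
have lin_cont (T : topologicalType) (u w : T -> Y) :
    continuous u -> continuous w -> continuous (fun t => a *: u t + w t).
  move=> cu cw t; apply: cvg_add; last exact: cw.
  by apply: cvg_scale; exact: cu.
split=> [|j jl]; first exact: (lin_cont _ _ _ fC.1 gC.1).
have linE z : R° z -> 'valL_ 0 (a *: f + g) z = a *: 'valL_ 0 f z + 'valL_ 0 g z.
  by move=> /interior_subset; exact: valL_lin.
have df := isC_iter_derivable fC jl; have dg := isC_iter_derivable gC jl.
split=> [ys y sz x Rx|].
  apply: (iter_derivable_lin (@open_interior _ R) linE df dg) => //.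
  by rewrite -sz size_rcons.
have [f' [cf' f'E]] := (fC.2 _ jl).2; have [g' [cg' g'E]] := (gC.2 _ jl).2.
exists (fun p => a *: f' p + g' p); split; first exact: lin_cont.
move=> x y Rx; rewrite f'E// g'E// /djet.
rewrite (iter_dderiv_lin (@open_interior _ R) linE df dg)//.
by rewrite size_map size_enum_ord.
Qed.

End isC_closed.

Section Cspace.
Context {K : realType} {X : lcsType K}.
Variables (l : smoothness) (R : set X) (Y : lcsType K).

HB.instance Definition _ :=
  GRing.isSubmodClosed.Build K (R -> Y) (@Cpred K X Y R l)
    (@isC_submod_closed K X Y R l).

Record Cspace := MkCspace {
  Cspace_fun :> R -> Y;
  Cspace_subproof : Cspace_fun \in @Cpred K X Y R l
}.

HB.instance Definition _ := [isSub for Cspace_fun].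
HB.instance Definition _ := [Choice of Cspace by <:].
HB.instance Definition _ := [SubChoice_isSubLmodule of Cspace by <:].

Definition toC (f : R -> Y) (fC : isC l f) : Cspace := MkCspace (asboolT fC).

Lemma CspaceP (f : Cspace) : isC l f.
Proof. exact: asboolW (Cspace_subproof f). Qed.

(* The compact-open C^l-topology. Here [{compact-open, T -> Y}] carries all
   functions from [T] to [Y]; the space of continuous functions is a topological
   subspace, so the initial topology is the same. *)
Definition CspaceTop : Type :=
  sup_topology (fun j : {j : nat | le_smooth j l} =>
    Topological.class (initial_topology (fun f : Cspace =>
      djet_map f (val j) :
        {compact-open, (R * {ptws 'I_(val j) -> X})%type -> Y}))).

HB.instance Definition _ := Topological.copy Cspace CspaceTop.

End Cspace.

(* Main.v *)
Require Import Defs.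
From mathcomp Require Import all_boot all_order all_algebra.
From mathcomp Require Import all_classical all_reals all_analysis.
From mathcomp Require Import ring zify.

Set Implicit Arguments.
Unset Strict Implicit.
Unset Printing Implicit Defensive.

Import Order.TTheory GRing.Theory Num.Theory.
Import numFieldNormedType.Exports.

Local Open Scope classical_set_scope.
Local Open Scope ring_scope.

(**
  A function is called k-continuous when its composite with every continuous map
  from a compact space is continuous. Evaluation C(T, Y) x T -> Y is k-continuous
  without local compactness of T, and k-continuous maps are closed under
  composition. By the chain rule (where boundary points of S are handled by the
  mean value theorem on small convex neighbourhoods), all mixed partial
  derivatives of (z, x) |-> gamma(z)(eta(z)(x)) are given by the Faa di Bruno
  formula, hence are k-continuous. For fixed z they are continuous, so zeta(z)
  and the candidates for its derivatives in z are C^l. The mean value theorem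
  turns pointwise derivatives with k-continuous candidates into derivatives in
  the compact-open topology; mixed derivatives are interchanged by Schwarz's
  theorem.

  It remains to see that d^(j) zeta is continuous on A x Z^j. On the diagonal,
  (z, w) |-> d^(j) zeta (z, w, ..., w) is k-continuous on the k_R-space A x Z, and
  therefore continuous. Since d^(j) zeta (z, -) is symmetric and multilinear for
  interior z, polarization provides the continuous extension to A x Z^j.
*)

(** * Compactness and k_R-spaces *)

(** The obstacle is that evaluating a map at a moving point is in general not continuous for the
    compact-open topology, so the formula for the derivatives of the composite can only be tested
    along compact spaces. The k_R-property of [A * Z] turns such tests into continuity on [A * Z],
    but says nothing about A x Z^j; this is why only the diagonal, where all directions coincide, is
    treated directly. Even for interior [z] and [x], the point [eta z x] may lie on the boundary of
    [S], where the derivatives of [gamma z] exist only as continuous extensions. The chain rule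
    therefore needs a mean value argument inside [S], and this is where local convexity of [S]
    enters. C^l(R, F) is used as a Hausdorff module with a topology. Multilinearity and symmetry of
    the derivatives of [zeta] are obtained after evaluation at the points of [R], where the values
    lie in the locally convex space [F]. *)

Lemma compact_set_type (T : topologicalType) (C : set T) :
  compact C -> compact [set: C].
Proof.
move=> cC F FF _.
have FC : (val @ F) C.
  by rewrite /fmap/=; apply: filterS filterT => x _; exact: set_mem (valP x).
have [p [Cp clp]] := cC (val @ F) _ FC.
exists (SigSub (mem_set Cp)); split=> // B U FB [V [[W oW WV]]] /=.
move=> Vp VU.
have FvB : (val @ F) (val @` B).
  by rewrite /fmap/=; apply: filterS FB => x; exists x.
have Wp : W p by move: Vp; rewrite -WV.
have [_ [[b Bb <-] Wb]] := clp _ _ FvB (open_nbhs_nbhs (conj oW Wp)).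
by exists b; split=> //; apply: VU; rewrite -WV.
Qed.

Lemma compact_open_evaluation (P T Y : topologicalType) (c : P -> T)
    (F : set_system P) (q : P -> T -> Y) (g : T -> Y) (p : P) :
  regular_space Y -> compact [set: P] -> continuous c -> continuous g ->
  Filter F -> F --> p ->
  (q @ F : set_system {compact-open, T -> Y}) --> (g : {compact-open, T -> Y}) ->
  (fun x => q x (c x)) @ F --> g (c p).
Proof.
move=> regY cP cc cg FF Fp /compact_open_cvgP qg U /= nU.
have nUo : nbhs (g (c p)) U°.
  by apply: open_nbhs_nbhs; split; [exact: open_interior|].
have [V nV VU] := regY _ _ nUo.
have cgc : continuous (g \o c) by move=> x; apply: continuous_comp; [exact: cc|exact: cg].
pose N := (g \o c) @^-1` closure V.
have cN : compact N.
  apply: (subclosed_compact _ cP) => //.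
  by apply: closed_comp; [move=> x _; exact: cgc|exact: closed_closure].
have nN : nbhs p N.
  by apply: (cgc p); apply: filterS nV; exact: subset_closure.
have ccN : compact (c @` N).
  by apply: continuous_compact => //; apply: continuous_subspaceT.
have FN : F N := Fp _ nN.
have FU : F [set x | q x @` (c @` N) `<=` U°].
  apply: (qg _ _ ccN (open_interior U)).
  by move=> _ [_ [x Nx <-] <-]; exact: VU.
change (F [set x | U (q x (c x))]); apply: filterS2 FU FN => x qxU Nx.
by apply: (@interior_subset _ U); apply: qxU; exists (c x) => //; exists x.
Qed.

Definition kcontinuous (T Y : topologicalType) (f : T -> Y) : Prop :=
  forall (P : topologicalType) (c : P -> T), compact [set: P] ->
    continuous c -> continuous (f \o c).

(** The k_R-property only speaks of real-valued functions. Uniform spaces are completely regular, so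
    some [u] vanishes at [f x] and is 1 off [U°]; continuity of [u \o f] suffices. The compact
    subsets of [Q], as spaces, are among the test spaces of [kcontinuous]. *)
Lemma kR_continuous (K : realType) (Q : topologicalType) (W : uniformType)
    (f : Q -> W) : kR_space K Q -> kcontinuous f -> continuous f.
Proof.
move=> [_ kQ] fc x U nU.
have [u [cu _ u0 u1]] : exists u : W -> K,
    [/\ continuous u, range u `<=` `[0, 1], u @` [set f x] `<=` [set 0]
      & u @` (~` U°) `<=` [set 1]].
  apply/uniform_separatorP; apply: (@uniform_completely_regular K).
    by apply: open_closedC; exact: open_interior.
  by apply.
have cuf : continuous (u \o f).
  apply: kQ => C cC; apply/subspace_sigL_continuousP => /=.
  rewrite /sigL -compA => y.
  apply: continuous_comp; last exact: cu.
  apply: fc; first exact: compact_set_type.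
  exact: initial_continuous.
have ux : u (f x) = 0 by apply: u0; exists (f x).
change (\forall y \near x, U (f y)); near=> y.
apply: (@interior_subset _ U); apply: contrapT => nUy.
have uy : u (f y) = 1 by apply: u1; exists (f y).
have : u (f y) < 1.
  near: y; apply: (cuf x (fun t => t < 1)) => /=.
  by rewrite ux; apply: lt_nbhsl; exact: ltr01.
by rewrite uy ltxx.
Unshelve. all: by end_near. Qed.

(** A tube argument: continuity at [(p, x)] compares both [G p t] and [G p' t] with [G p x], and
    finitely many such estimates cover [C]. The topology of uniform convergence on compact sets is
    chosen because [kR_continuous] asks for a uniform codomain. *)
Lemma curry_family_compact (P T : topologicalType) (W : uniformType)
    (G : P -> T -> W) :
  (forall C : set T, compact C ->
    continuous (fun x : P * C => G x.1 (val x.2))) ->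
  continuous (G : P -> {family compact, T -> W}).
Proof.
move=> kG p; apply/fam_cvgP => C cC U /uniform_nbhs[E [entE EU]].
apply: (filterS EU); rewrite nbhs_simpl /=.
have /compact_near_coveringP/(_ P (nbhs p)) := compact_set_type cC.
move=> /(_ (fun p' (t : C) => E (G p (val t), G p' (val t)))) /=.
move=> cov; suff : \forall p' \near p, forall t : C, E (G p (val t), G p' (val t)).
  by apply: filterS => p' Ep' t Ct; exact: (Ep' (SigSub (mem_set Ct))).
have {}cov := cov (nbhs_filter p); near=> p' => t.
have: [set: C] `<=` (fun t : C => E (G p (val t), G p' (val t))).
  near: p'; apply: cov => x _.
  have /cvg_app_entourageP cE := kG C cC (p, x).
  have eE := entourage_split_ent entE.
  have [[A B] /= [nA nB] AB] := cE _ (filterI eE (entourage_inv eE)).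
  exists (B, A); first by split.
  move=> -[t p'] /= [Bt Ap'].
  have [_ H1] := AB (p, t) (conj (nbhs_singleton nA) Bt).
  have [H2 _] := AB (p', t) (conj Ap' Bt).
  exact: entourage_split H1 H2.
by apply.
Unshelve. all: by end_near. Qed.

(** * Mean value theorem *)

Lemma cvg_scalel (K : realType) (Y : lcsType K) (T : Type) (F : set_system T)
    (FF : Filter F) (c : T -> K) (u : T -> Y) (a : K) (b : Y) :
  c @ F --> a -> u @ F --> b -> (fun t => c t *: u t) @ F --> a *: b.
Proof.
move=> ca ub.
exact: (cvg_comp2 (ca : (c : T -> K^o) @ F --> (a : K^o)) ub
  (@scale_continuous K Y (a, b))).
Qed.

Lemma cvg_sub (K : realType) (Y : lcsType K) (T : Type) (F : set_system T)
    (FF : Filter F) (u w : T -> Y) (a b : Y) :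
  u @ F --> a -> w @ F --> b -> (fun t => u t - w t) @ F --> a - b.
Proof.
move=> ua wb; apply: cvg_add => //; rewrite -scaleN1r.
rewrite (_ : (fun t => - w t) = (fun t => -1 *: w t)); first exact: cvg_scale.
by apply/funext => t; rewrite scaleN1r.
Qed.

Lemma convex_comb (K : realType) (V : lmodType K) (D : set V) (x y : V) (t : K) :
  convex_set D -> D x -> D y -> 0 <= t -> t <= 1 -> D (t *: x + (1 - t) *: y).
Proof.
move=> cD Dx Dy t0 t1.
exact: (set_mem (cD x y (Itv01 t0 t1) (mem_set Dx) (mem_set Dy))).
Qed.

Lemma convex_segment (K : realType) (V : lmodType K) (D : set V) (x e : V)
    (h t : K) :
  convex_set D -> D x -> D (x + h *: e) -> 0 <= t -> t <= 1 ->
  D (x + (t * h) *: e).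
Proof.
move=> cD Dx Dy t0 t1; have := convex_comb cD Dy Dx t0 t1.
by rewrite scalerDr scalerA addrAC -scalerDl (addrC t) subrK scale1r.
Qed.

Lemma lcs_convex_nbhs (K : realType) (F : lcsType K) (x : F) (V : set F) :
  nbhs x V -> exists W, [/\ open W, convex_set W, W x & W `<=` V].
Proof.
move=> nV; have [B Bc [Bo Bb]] := @locally_convex K F.
have [W [BW Wx] WV] := Bb x _ nV.
by exists W; split; [exact: Bo|exact: (Bc _ (mem_set BW))|exact: Wx|exact: WV].
Qed.

Lemma lcs_convex_nbhs_closure (K : realType) (F : lcsType K) (x : F) (V : set F) :
  nbhs x V -> exists W, [/\ open W, convex_set W, W x & closure W `<=` V].
Proof.
move=> nV; have [U nU UV] := @uniform_regular F x V nV.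
have [W [oW cW Wx WU]] := lcs_convex_nbhs nU.
by exists W; split=> //; apply: subset_trans UV; exact: closureS.
Qed.

Definition curve_deriv (K : realType) (Y : lcsType K) (phi : K -> Y) (t : K)
    (d : Y) : Prop :=
  (fun h : K => h^-1 *: (phi (t + h) - phi t)) @ 0^' --> d.

Lemma has_dderiv_line (K : realType) (X Y : lcsType K) (f : X -> Y) x v t d :
  has_dderiv f (x + t *: v) v d <-> curve_deriv (fun s => f (x + s *: v)) t d.
Proof.
rewrite /has_dderiv /curve_deriv.
rewrite (_ : (fun h : K => _) = (fun h => h^-1 *: (f (x + (t + h) *: v) - f (x + t *: v))))//.
by apply/funext => h; rewrite scalerDl addrA.
Qed.

(** A form of Cousin's lemma. Let [c] be the supremum of the points reachable from [a]: the
    left-hand condition at [c] shows that [c] is reachable, and the right-hand one leads beyond [c]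
    unless [c = b]. *)
Lemma interval_chain (K : realType) (P : K -> K -> Prop) (a b : K) : a < b ->
  (forall x y z, x < y -> y < z -> P x y -> P y z -> P x z) ->
  (forall t, a <= t <= b -> exists2 d, 0 < d &
     forall s, (t < s < t + d -> P t s) /\ (t - d < s < t -> P s t)) ->
  P a b.
Proof.
move=> ab Ptr Ploc.
pose S := [set t | a <= t <= b /\ (t = a \/ P a t)].
have Sa : S a by split; [rewrite lexx ltW|left].
have ubS : has_ubound S by exists b => t [/andP[]].
have supS : has_sup S by split; [exists a|].
set c := sup S.
have ac : a <= c by apply: ub_le_sup.
have cb : c <= b by apply: sup_le_ub => //; [exists a|move=> t [/andP[]]].
have [|d d0 Pd] := Ploc c; first by rewrite ac cb.
have Sc : S c.
  have [s Ss sc] := sup_adherent d0 supS.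
  have := ub_le_sup ubS Ss; rewrite -/c le_eqVlt => /predU1P[<-//|ltsc].
  split; first by rewrite ac cb.
  right; have Psc : P s c by apply: (Pd s).2; rewrite sc ltsc.
  case: Ss => /andP[as_ sb] [<-//|Pas].
  move: as_; rewrite le_eqVlt => /predU1P[->//|as_].
  exact: Ptr Pas Psc.
have [cltb|] := ltP c b; last first.
  move=> bc; have cbE : c = b by apply/eqP; rewrite eq_le cb bc.
  case: Sc => _ [ca|]; last by rewrite cbE.
  by move: ab; rewrite -cbE ca ltxx.
exfalso; pose s := Num.min b (c + d / 2).
have cs : c < s by rewrite lt_min cltb ltrDl divr_gt0.
have scd : s < c + d by rewrite gt_min ltrD2l ltr_pdivrMr// mulr_natr mulr2n ltrDl d0 orbT.
have Pcs : P c s by apply: (Pd s).1; rewrite cs scd.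
have : S s.
  split; first by rewrite (le_trans ac (ltW cs)) ge_min lexx.
  right; case: Sc => _ [<-//|Pac]; move: ac; rewrite le_eqVlt => /predU1P[->//|ac'].
  exact: Ptr Pac Pcs.
by move=> /(ub_le_sup ubS); rewrite leNgt cs.
Qed.

(* The slope over [a, b] is a convex combination of slopes over subintervals,
   and slopes over intervals shrinking to a point [t] approach the derivative
   at [t]: no completeness of [Y] is needed. *)
Lemma convex_mean_value (K : realType) (Y : lcsType K) (phi dphi : K -> Y)
    (D : set Y) (a b : K) : a < b -> open D -> convex_set D ->
  (forall t, a <= t <= b -> curve_deriv phi t (dphi t) /\ D (dphi t)) ->
  D ((b - a)^-1 *: (phi b - phi a)).
Proof.
move=> ab oD cD dD.
pose P s t := D ((t - s)^-1 *: (phi t - phi s)).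
apply: (@interval_chain K P) => // [x y z xy yz Pxy Pyz|t tab].
  have xz : x < z by exact: lt_trans yz.
  have [xy0 yz0 xz0] : [/\ y - x != 0, z - y != 0 & z - x != 0].
    by rewrite !gt_eqF ?subr_gt0.
  have [t0 t1] : 0 <= (y - x) / (z - x) /\ (y - x) / (z - x) <= 1.
    split; first by rewrite divr_ge0 ?subr_ge0 ?ltW.
    by rewrite ler_pdivrMr ?subr_gt0// mul1r lerD2r ltW.
  have := convex_comb cD Pxy Pyz t0 t1.
  rewrite /P (_ : 1 - _ = (z - y) / (z - x)); last by field.
  rewrite !scalerA mulrAC divff// mul1r (mulrAC (z - y)) divff// mul1r.
  rewrite -scalerDr (_ : phi y - phi x + (phi z - phi y) = phi z - phi x)//.
  by rewrite addrC addrA subrK.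
have [dt Dt] := dD _ tab.
have nD : nbhs (dphi t) D by exact: open_nbhs_nbhs.
have := dt _ nD; rewrite /fmap /= => -[d /= d0 dP].
exists d => // s; split=> /andP[ts sd].
  have -> : s = t + (s - t) by rewrite addrC subrK.
  rewrite /P (addrC t) addrK (addrC _ t); apply: dP => /=.
    by rewrite sub0r normrN gtr0_norm ?subr_gt0// ltrBlDl.
  by rewrite subr_eq0 gt_eqF.
have : D ((s - t)^-1 *: (phi (t + (s - t)) - phi t)).
  apply: dP => /=.
    by rewrite sub0r normrN ltr0_norm ?subr_lt0// opprB ltrBlDl -ltrBlDr.
  by rewrite subr_eq0 lt_eqF.
rewrite (addrC t) subrK /P -[t - s]opprB -[phi t - _]opprB.
by rewrite invrN scalerN scaleNr opprK.
Qed.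

(** A slope does not change when the two ends are exchanged; this covers negative [h], and the
    parameter [t * h] describes the segment for both signs. *)
Lemma convex_mean_value0 (K : realType) (Y : lcsType K) (phi dphi : K -> Y)
    (D : set Y) (h : K) : h != 0 -> open D -> convex_set D ->
  (forall t, 0 <= t <= 1 ->
    curve_deriv phi (t * h) (dphi (t * h)) /\ D (dphi (t * h))) ->
  D (h^-1 *: (phi h - phi 0)).
Proof.
move=> h0 oD cD dD; have [hp|hn] := ltP 0 h.
  have := @convex_mean_value K Y phi dphi D 0 h hp oD cD; rewrite subr0; apply.
  move=> t /andP[t0 th]; rewrite -[t](divfK h0); apply: dD.
  by rewrite divr_ge0// ?(ltW hp)//= ler_pdivrMr// mul1r.
have {}hn : h < 0 by rewrite lt_neqAle h0.
have -> : h^-1 *: (phi h - phi 0) = (0 - h)^-1 *: (phi 0 - phi h).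
  by rewrite sub0r invrN scaleNr -scalerN opprB.
apply: (@convex_mean_value K Y phi dphi D h 0 hn oD cD).
move=> t /andP[ht t0]; rewrite -[t](divfK h0); apply: dD.
by rewrite mulr_le0 ?invr_le0 ?(ltW hn)//= ler_ndivrMr// mul1r.
Qed.

Lemma near_abs_lt (K : realType) (P : K -> Prop) :
  (\forall h \near (0 : K), P h) <->
  exists2 d : K, 0 < d & forall h, `|h| < d -> P h.
Proof.
split=> [[d d0 dP]|[d d0 dP]]; exists d => //.
  by move=> h hd; apply: dP => /=; rewrite sub0r normrN.
by move=> h /=; rewrite sub0r normrN; exact: dP.
Qed.

Lemma abs_scale_le (K : realType) (t h d : K) :
  0 <= t <= 1 -> `|h| < d -> `|t * h| < d.
Proof.
move=> /andP[t0 t1]; apply: le_lt_trans.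
by rewrite normrM ger0_norm// ler_piMl.
Qed.

(* The difference quotient of [G ^~ x] over [0, h] lies in every open convex set
   containing the derivatives [G' t x] for [t] in [0, h], so joint continuity of
   [G'] near [{0} x C] gives uniformity on [C]. *)
Lemma compact_open_deriv (K : realType) (T : topologicalType) (Y : lcsType K)
    (G G' : K -> T -> Y) :
  (\forall s \near (0 : K), forall x, curve_deriv (G ^~ x) s (G' s x)) ->
  (forall (C : set T) (x : C), compact C ->
    {for (0, x), continuous (fun p : K * C => G' p.1 (val p.2))}) ->
  (fun h => h^-1 *: (G h - G 0) : {compact-open, T -> Y}) @ 0^' -->
    (G' 0 : {compact-open, T -> Y}).
Proof.
move=> /near_abs_lt[d d0 dG] cG'; apply/compact_open_cvgP => C O cC oO CO.
have /compact_near_coveringP := compact_set_type cC.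
move=> /(_ K 0^' (fun h (x : C) => O ((h^-1 *: (G h - G 0)) (val x)))) cov.
have {}cov : \forall h \near (0 : K)^',
    [set: C] `<=` (fun x : C => O ((h^-1 *: (G h - G 0)) (val x))).
  apply: cov => x _.
  have [|W [oW cW Wx WO]] := @lcs_convex_nbhs K Y (G' 0 (val x)) O.
    apply: open_nbhs_nbhs; split=> //; apply: CO.
    by exists (val x) => //; exact: set_mem (valP x).
  have [|[A B] /= [/near_abs_lt[e e0 eA] nB] AB] := cG' C x cC W.
    exact: open_nbhs_nbhs.
  exists (B, [set h | h != 0 /\ `|h| < Num.min d e]); first split=> //.
    have h0 : 0^' [set h : K | h != 0] by exact: (@nbhs_dnbhs_neq _ (0 : K)).
    apply: filterI h0 _.
    apply: nbhs_dnbhs; apply/near_abs_lt; exists (Num.min d e) => //.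
    by rewrite lt_min d0 e0.
  move=> -[y h] /= [By [h0]]; rewrite lt_min => /andP[hd he].
  apply: WO; apply: (@convex_mean_value0 K Y (fun s => G s (val y))
      (fun s => G' s (val y)) W h h0 oW cW) => t t01.
  split; first by apply: dG; exact: abs_scale_le.
  by apply: (AB (t * h, y)); split=> //=; apply: eA; exact: abs_scale_le.
apply: filterS cov => h hO _ [x Cx <-].
exact: (hO (SigSub (mem_set Cx))).
Qed.

(** * Mixed partial derivatives and difference quotients *)

Lemma near_pair_lt (K : realType) (P : K -> K -> Prop) :
  (\forall p \near ((0, 0) : K * K), P p.1 p.2) ->
  exists2 d : K, 0 < d & forall s t, `|s| < d -> `|t| < d -> P s t.
Proof.
move=> [[A B] /= [/near_abs_lt[d d0 dA] /near_abs_lt[e e0 eB]] AB].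
exists (Num.min d e); first by rewrite lt_min d0 e0.
move=> s t; rewrite !lt_min => /andP[sd _] /andP[_ te].
by apply: (AB (s, t)); split; [exact: dA|exact: eB].
Qed.

(** The estimate is uniform in [s]. This permits [s = t] in [has_dderivD], and a second mean value
    argument, in [s], in [mixed_quotient]. *)
Lemma partial_quotient (K : realType) (Y : lcsType K) (phi psi : K -> K -> Y)
    (V : set Y) :
  (\forall p \near ((0, 0) : K * K), curve_deriv (phi p.1) p.2 (psi p.1 p.2)) ->
  {for (0, 0), continuous (fun p : K * K => psi p.1 p.2)} ->
  nbhs (psi 0 0) V ->
  exists2 d : K, 0 < d & forall s t, `|s| < d -> `|t| < d -> t != 0 ->
    V (t^-1 *: (phi s t - phi s 0)).
Proof.
move=> dphi cpsi nV; have [W [oW cW W0 WV]] := lcs_convex_nbhs nV.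
have nW : \forall p \near ((0, 0) : K * K), W (psi p.1 p.2).
  by apply: cpsi; exact: open_nbhs_nbhs.
have [d d0 dP] := near_pair_lt (P := fun s t =>
  curve_deriv (phi s) t (psi s t) /\ W (psi s t)) (filterI dphi nW).
exists d => // s t sd td t0; apply: WV.
apply: (@convex_mean_value0 K Y (phi s) (psi s) W t t0 oW cW) => r r01.
by apply: dP => //; exact: abs_scale_le.
Qed.

(** The quotient along [v + w] is the quotient along [v] at [x] plus the quotient along [w] at the
    moving point [x + h *: v]; the latter is [partial_quotient] on the diagonal. *)
Lemma has_dderivD (K : realType) (X Y : lcsType K) (f g : X -> Y) x v w d :
  (\forall p \near ((0, 0) : K * K),
     has_dderiv f (x + p.1 *: v + p.2 *: w) w (g (x + p.1 *: v + p.2 *: w))) ->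
  {for (0, 0), continuous (fun p : K * K => g (x + p.1 *: v + p.2 *: w))} ->
  has_dderiv f x v d -> has_dderiv f x (v + w) (d + g x).
Proof.
move=> dg cg fd.
pose q h := h^-1 *: (f (x + h *: v + h *: w) - f (x + h *: v)).
have qg : q @ 0^' --> g x.
  move=> V nV.
  have [|||d' d0 dP] := @partial_quotient K Y
      (fun s t => f (x + s *: v + t *: w)) (fun s t => g (x + s *: v + t *: w)) V.
  - by apply: filterS dg => p /has_dderiv_line.
  - exact: cg.
  - by rewrite !scale0r !addr0.
  rewrite /fmap /=; have n0 := @nbhs_dnbhs_neq _ (0 : K).
  have nd : \forall h \near (0 : K)^', `|h| < d'.
    by apply: nbhs_dnbhs; apply/near_abs_lt; exists d'.
  change (\forall h \near (0 : K)^', V (q h)).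
  apply: filterS2 n0 nd => h h0 hd; have := dP h h hd hd h0.
  by rewrite scale0r addr0.
have -> : d + g x = g x + d by rewrite addrC.
rewrite /has_dderiv; apply: cvg_trans (cvg_add _ qg fd); apply: near_eq_cvg.
apply: nearW => h; rewrite /q [h *: (v + w)]scalerDr [x + (_ + _)]addrA.
by rewrite -[LHS]scalerDr; congr (_ *: _); rewrite addrA subrK.
Qed.

(** The mean value theorem in [s] is applied to the quotient of [phi] in [t]. Its derivative in [s]
    is the quotient of [a] in [t], which [partial_quotient] keeps in the convex set [W]. *)
Lemma mixed_quotient (K : realType) (Y : lcsType K) (phi a c : K -> K -> Y)
    (V : set Y) :
  (\forall p \near ((0, 0) : K * K), curve_deriv (phi ^~ p.2) p.1 (a p.1 p.2)) ->
  (\forall p \near ((0, 0) : K * K), curve_deriv (a p.1) p.2 (c p.1 p.2)) ->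
  {for (0, 0), continuous (fun p : K * K => c p.1 p.2)} ->
  nbhs (c 0 0) V ->
  exists2 d : K, 0 < d & forall s t,
    `|s| < d -> `|t| < d -> s != 0 -> t != 0 ->
    V ((s * t)^-1 *: (phi s t - phi s 0 - phi 0 t + phi 0 0)).
Proof.
move=> dphi da cc nV; have [W [oW cW W0 WV]] := lcs_convex_nbhs nV.
have [|d1 d10 d1P] := partial_quotient da cc (V := W); first exact: open_nbhs_nbhs.
have [d2 d20 d2P] := near_pair_lt (P := fun s t =>
  curve_deriv (phi ^~ t) s (a s t)) dphi.
exists (Num.min d1 d2); first by rewrite lt_min d10 d20.
move=> s t; rewrite !lt_min => /andP[s1 s2] /andP[t1 t2] s0 t0; apply: WV.
have -> : (s * t)^-1 *: (phi s t - phi s 0 - phi 0 t + phi 0 0) =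
    s^-1 *: (t^-1 *: (phi s t - phi s 0) - t^-1 *: (phi 0 t - phi 0 0)).
  by rewrite -scalerBr scalerA invfM opprB addrA addrAC.
apply: (@convex_mean_value0 K Y (fun s => t^-1 *: (phi s t - phi s 0))
  (fun s => t^-1 *: (a s t - a s 0)) W s s0 oW cW) => r r01.
have rs1 : `|r * s| < d1 by exact: abs_scale_le.
have rs2 : `|r * s| < d2 by exact: abs_scale_le.
split; last exact: d1P.
have D1 := d2P _ _ rs2 t2; have D2 : curve_deriv (phi ^~ 0) (r * s) (a (r * s) 0).
  by apply: d2P => //; rewrite normr0.
rewrite /curve_deriv.
apply: cvg_trans (cvg_scale _ (c := t^-1) (cvg_sub _ D1 D2)).
apply: near_eq_cvg; apply: nearW => h.
rewrite -!scalerBr !scalerA (mulrC t^-1); congr (_ *: _).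
by rewrite !opprD !opprK addrACA.
Qed.

(** Schwarz's theorem. The second difference of [phi] is symmetric in its two steps, so
    [mixed_quotient] places one and the same value in given neighbourhoods of [c 0 0] and of
    [d 0 0]. *)
Lemma mixed_partials_eq (K : realType) (Y : lcsType K)
    (phi a b c d : K -> K -> Y) :
  (\forall p \near ((0, 0) : K * K),
    [/\ curve_deriv (phi ^~ p.2) p.1 (a p.1 p.2),
        curve_deriv (a p.1) p.2 (c p.1 p.2),
        curve_deriv (phi p.1) p.2 (b p.1 p.2)
      & curve_deriv (b ^~ p.2) p.1 (d p.1 p.2)]) ->
  {for (0, 0), continuous (fun p : K * K => c p.1 p.2)} ->
  {for (0, 0), continuous (fun p : K * K => d p.1 p.2)} ->
  c 0 0 = d 0 0.
Proof.
move=> D cc cd; apply: (@lcs_hausdorff K Y) => A B nA nB.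
have [||||d1 d10 d1P] := @mixed_quotient K Y phi a c A.
- by apply: filterS D => p [].
- by apply: filterS D => p [].
- exact: cc.
- exact: nA.
have swapD : \forall p \near ((0, 0) : K * K),
    curve_deriv (phi p.2) p.1 (b p.2 p.1) /\
    curve_deriv (b ^~ p.1) p.2 (d p.2 p.1).
  have sD : \forall p \near ((0, 0) : K * K), [/\ curve_deriv (phi ^~ p.1) p.2 (a p.2 p.1),
        curve_deriv (a p.2) p.1 (c p.2 p.1),
        curve_deriv (phi p.2) p.1 (b p.2 p.1)
      & curve_deriv (b ^~ p.1) p.2 (d p.2 p.1)].
    exact: (@swap_continuous K K (0, 0) _ D).
  by apply: filterS sD => p [].
have [||||d2 d20 d2P] := @mixed_quotient K Y (fun s t => phi t s)
   (fun s t => b t s) (fun s t => d t s) B.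
- by apply: filterS swapD => p [].
- by apply: filterS swapD => p [].
- by move=> U /cd nU; exact: (@swap_continuous K K (0, 0) _ nU).
- exact: nB.
pose h := Num.min d1 d2 / 2.
have m0 : 0 < Num.min d1 d2 by rewrite lt_min d10 d20.
have h0 : 0 < h by rewrite divr_gt0.
have hm : `|h| < Num.min d1 d2.
  by rewrite gtr0_norm// ltr_pdivrMr// mulr_natr mulr2n ltrDl.
move: hm; rewrite lt_min => /andP[h1 h2].
exists ((h * h)^-1 *: (phi h h - phi h 0 - phi 0 h + phi 0 0)); split.
  by apply: d1P; rewrite ?gt_eqF.
have := d2P h h h2 h2; rewrite !gt_eqF// => /(_ isT isT).
by rewrite (addrAC (phi h h)).
Qed.

(** Translating the segment by a small vector [z - y] keeps both ends in the open set [A]. Hence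
    every [z] near [y] lies on a segment of the convex set [U]. *)
Lemma convex_interior_segment (K : realType) (E : lcsType K) (U A : set E)
    (x e : E) (h t : K) :
  convex_set U -> open A -> A `<=` U -> A x -> A (x + h *: e) ->
  0 <= t <= 1 -> U° (x + (t * h) *: e).
Proof.
move=> cU oA AU Ax Ay /andP[t0 t1]; set y := _ + _ *: e.
have shift (w : E) : A w -> \forall z \near y, A (w + (z - y)).
  move=> Aw; have : (fun z => w + (z - y)) @ y --> w + (y - y).
    apply: cvg_add; first exact: cvg_cst.
    by apply: cvg_sub; [exact: cvg_id|exact: cvg_cst].
  rewrite subrr addr0 => /(_ A); apply; exact: open_nbhs_nbhs.
rewrite /interior /=; apply: filterS2 (shift _ Ax) (shift _ Ay) => z Az Az'.
rewrite -addrAC in Az'.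
have := convex_segment cU (AU _ Az) (AU _ Az') t0 t1.
by rewrite addrAC -/y addrC subrK.
Qed.

(* Differences over segments inside [S] are limits of differences over segments
   inside the interior of [S], on which the mean value theorem applies. *)
Lemma difference_quotient_near (K : realType) (E F : lcsType K)
    (P : topologicalType) (S : set E) (Phi : E -> P -> F)
    (DPhi : E -> P -> E -> F) (s0 : E) (u0 : P) (e0 : E) (V : set F) :
  locally_convex_subset S -> regular_subset S -> S s0 ->
  (forall s u e, S° s -> has_dderiv (Phi ^~ u) s e (DPhi s u e)) ->
  (forall s u, S s -> (Phi ^~ u) @ within S (nbhs s) --> Phi s u) ->
  (forall W, nbhs (DPhi s0 u0 e0) W -> exists O N M,
    [/\ nbhs s0 O, nbhs u0 N, nbhs e0 M &
        forall s u e, S s -> O s -> N u -> M e -> W (DPhi s u e)]) ->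
  nbhs (DPhi s0 u0 e0) V ->
  exists O N M, [/\ nbhs s0 O, nbhs u0 N, nbhs e0 M &
    forall s u e h, h != 0 -> S s -> O s -> S (s + h *: e) -> O (s + h *: e) ->
      N u -> M e -> V (h^-1 *: (Phi (s + h *: e) u - Phi s u))].
Proof.
move=> lcS regS Ss0 dPhi cPhi cD nV.
(* The quotient will only be a limit of elements of [W], so the closure of [W] has to fit into
   [V]. *)
have [W [oW cW W0 WV]] := lcs_convex_nbhs_closure nV.
have [B1 [N [M [nO1 nN nM D_W]]]] := cD W (open_nbhs_nbhs (conj oW W0)).
have [U [nU US cU]] := lcS _ Ss0.
(* As [U] is a neighbourhood relative to [S], this gives [S] &[Q]<=[U]: segments between points of
   [S] in [Q] stay in [U], hence in [S], and also in [Q]. *)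
have [Q [oO cO Os0 OO]] := lcs_convex_nbhs (filterI nO1 nU).
exists Q, N, M°; split=> //.
- exact: open_nbhs_nbhs.
- by apply: open_nbhs_nbhs; split; [exact: open_interior|].
move=> s u e h h0 Ss Os Sb Ob Nu Me; apply: WV => B nB.
set b := s + h *: e in Sb Ob *.
have prs : ProperFilter (within S° (nbhs s)) by apply: within_nbhs_proper; exact: regS.
have prb : ProperFilter (within S° (nbhs b)) by apply: within_nbhs_proper; exact: regS.
have cPhi' (x : E) : S x -> (Phi ^~ u) @ within S° (nbhs x) --> Phi x u.
  move=> Sx; apply: (cvg_trans _ (cPhi x u Sx)); apply: cvg_app.
  exact: (within_subset _ (@interior_subset _ S)).
(* Both ends approach their limits independently through [S°]. The direction between them then
   changes as well, to one that tends to [e]; therefore the estimates have to be uniform in the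
   direction. *)
pose G := filter_prod (within S° (nbhs s)) (within S° (nbhs b)).
have G1 : fst @ G --> s by apply: (@cvg_trans _ (within S° (nbhs s))); [exact: cvg_fst|exact: cvg_within].
have G2 : snd @ G --> b by apply: (@cvg_trans _ (within S° (nbhs b))); [exact: cvg_snd|exact: cvg_within].
have qG : (fun p => h^-1 *: (Phi p.2 u - Phi p.1 u)) @ G -->
    h^-1 *: (Phi b u - Phi s u).
  apply: cvg_scale; apply: cvg_sub.
    exact: (cvg_comp _ _ (@cvg_snd _ _ (within S° (nbhs s)) (within S° (nbhs b)) _) (cPhi' b Sb)).
  exact: (cvg_comp _ _ (@cvg_fst _ _ (within S° (nbhs s)) (within S° (nbhs b)) _) (cPhi' s Ss)).
have eG : (fun p => h^-1 *: (p.2 - p.1)) @ G --> e.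
  have -> : e = h^-1 *: (b - s) by rewrite /b addrC addKr scalerA mulVf ?scale1r.
  by apply: cvg_scale; exact: cvg_sub.
have GO1 : G [set p | Q p.1] by apply: G1; exact: open_nbhs_nbhs.
have GO2 : G [set p | Q p.2] by apply: G2; exact: open_nbhs_nbhs.
have GS : G [set p | S° p.1 /\ S° p.2].
  exists (S°, S°); last by [].
  by split; exact: withinT.
have GM : G [set p | M° (h^-1 *: (p.2 - p.1))].
  by apply: eG; apply: open_nbhs_nbhs; split; [exact: open_interior|].
have GB : G [set p | B (h^-1 *: (Phi p.2 u - Phi p.1 u))] by exact: qG.
have [[s' b'] /= [[[[Q' Ob'] [Ss' Sb']] Me'] Bq]] :=
  filter_ex (filterI (filterI (filterI (filterI GO1 GO2) GS) GM) GB).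
exists (h^-1 *: (Phi b' u - Phi s' u)); split=> //.
set e' := h^-1 *: (b' - s') in Me'.
have b'E : s' + h *: e' = b' by rewrite scalerA mulfV// scale1r addrC subrK.
have := @convex_mean_value0 K F (fun t => Phi (s' + t *: e') u)
  (fun t => DPhi (s' + t *: e') u e') W h h0 oW cW.
rewrite b'E scale0r addr0; apply=> t t01.
have A_U : S° `&` Q `<=` U.
  by move=> x [Sx Ox]; exact: ((OO _ Ox).2 (interior_subset Sx)).
have U_pt : U° (s' + (t * h) *: e').
  apply: (@convex_interior_segment _ _ U (S° `&` Q)) => //.
  - by apply: openI => //; exact: open_interior.
  - by rewrite b'E.
have S_pt : S° (s' + (t * h) *: e') by apply: interiorS U_pt.
split; first exact: (has_dderiv_line (Phi ^~ u) s' e' (t * h) _).1 (dPhi _ _ _ S_pt).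
apply: D_W => //; [exact: interior_subset| |exact: interior_subset].
apply: (OO _ _).1; apply: convex_segment; rewrite ?b'E//.
- by case/andP: t01.
- by case/andP: t01.
Qed.

(** * Jets and the compact-open C^l-topology *)

Section jets.
Context {K : realType} {X : lcsType K} {Y : preTopologicalLmodType K}.
Implicit Types (R : set X) (ys : seq X).

(** Directions are given as a list, read with default 0, so that slots can be singled out and
    permuted by operations on lists. Only the first [n] entries matter. *)
Definition jet R (f : R -> Y) (n : nat) (x : R) ys : Y :=
  djet_map f n (x, fun i : 'I_n => nth 0 ys i).

Lemma valLE R (f : R -> Y) (x : R) : 'valL_ 0 f (val x) = f x.
Proof. by have := congr1 (@^~ x) (valLK 0 f). Qed.

Lemma valL_at R (f : R -> Y) (z : X) (Rz : R z) :
  'valL_ 0 f z = f (SigSub (mem_set Rz)).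
Proof. exact: (valLE f (SigSub (mem_set Rz))). Qed.

Lemma has_dderiv_eq_open (f g : X -> Y) (U : set X) (x v : X) (d : Y) :
  open U -> U x -> (forall z, U z -> f z = g z) ->
  has_dderiv f x v d -> has_dderiv g x v d.
Proof.
move=> oU Ux fg; apply: cvg_trans; apply: near_eq_cvg.
near=> h; rewrite !fg//; last by near: h; exact: near_line.
Unshelve. all: by end_near. Qed.

Lemma iter_dderiv_eq_open (f g : X -> Y) (U : set X) ys :
  open U -> (forall z, U z -> f z = g z) ->
  forall z, U z -> iter_dderiv ys f z = iter_dderiv ys g z.
Proof.
move=> oU; elim: ys f g => //= y ys IH f g fg; apply: IH => z Uz.
rewrite /dderiv; congr (xget _ _); apply/funext => d; apply/propext.
by split; apply: has_dderiv_eq_open oU Uz _ => w Uw; rewrite fg.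
Qed.

Lemma codom_nth (n : nat) ys : size ys = n ->
  codom (fun i : 'I_n => nth 0 ys i) = ys.
Proof.
move=> <-; rewrite codomE (map_comp (nth 0 ys) val) val_enum_ord.
exact: mkseq_nth.
Qed.

Lemma pointwise_nth_cvg (T : Type) (F : set_system T) (n : nat)
    (u : T -> seq X) ys : Filter F ->
  (forall i, (i < n)%N -> (fun t => nth 0 (u t) i) @ F --> nth 0 ys i) ->
  (fun t => (fun i : 'I_n => nth 0 (u t) i) : {ptws 'I_n -> X}) @ F -->
    ((fun i : 'I_n => nth 0 ys i) : {ptws 'I_n -> X}).
Proof.
move=> FF uys; apply/cvg_sup => i A [B [[W oW WB] Bf BA]].
apply: (filterS BA); rewrite -WB; apply: (uys i (ltn_ord i)).
by apply: open_nbhs_nbhs; split=> //; move: Bf; rewrite -WB.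
Qed.

Lemma djet_mapP R (l : smoothness) (f : R -> Y) (n : nat) :
  isC l f -> le_smooth n l -> djet_ext f (djet_map f n).
Proof. by move=> [_ fC] /fC[_ [g fg]]; exact: (xgetPex (fun=> 0) (ex_intro _ g fg)). Qed.

Lemma jet_cvg R (l : smoothness) (f : R -> Y) (n : nat) (T : Type)
    (F : set_system T) (r : T -> R) (u : T -> seq X) (x : R) ys : Filter F ->
  isC l f -> le_smooth n l -> r @ F --> x ->
  (forall i, (i < n)%N -> (fun t => nth 0 (u t) i) @ F --> nth 0 ys i) ->
  (fun t => jet f n (r t) (u t)) @ F --> jet f n x ys.
Proof.
move=> FF fC nl rx uys; have [cf _] := djet_mapP fC nl.
have uy := pointwise_nth_cvg FF uys.
apply: (cvg_comp2 (h := fun a b => djet_map f n (a, b)) rx uy) => /=.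
apply: (cvg_trans _ (cf (x, fun i : 'I_n => nth 0 ys i))).
by apply: near_eq_cvg; apply: nearW => -[].
Qed.

Lemma jet_interior R (l : smoothness) (f : R -> Y) (n : nat) (x : R) ys :
  isC l f -> le_smooth n l -> size ys = n -> R° (val x) ->
  jet f n x ys = iter_dderiv ys ('valL_ 0 f) (val x).
Proof.
move=> fC nl sz Rx; have [_ fE] := djet_mapP fC nl.
by rewrite /jet fE// /djet codom_nth.
Qed.

Lemma has_dderiv_jet R (l : smoothness) (f : R -> Y) (n : nat) (x : R) ys v :
  isC l f -> le_smooth n.+1 l -> size ys = n -> R° (val x) ->
  has_dderiv ('valL_ 0 (fun x => jet f n x ys)) (val x) v
    (jet f n.+1 x (rcons ys v)).
Proof.
move=> fC nl sz Rx.
have nl' : le_smooth n l by move: nl; rewrite /le_smooth; case: (l) => // ?; exact: ltnW.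
rewrite (jet_interior fC nl)// ?size_rcons ?sz//.
apply: (@has_dderiv_eq_open (iter_dderiv ys ('valL_ 0 f)) _ R°) => //.
- exact: open_interior.
- move=> z Rz; have [z' zE] : exists z' : R, z = val z'.
    by exists (SigSub (mem_set (interior_subset Rz))).
  rewrite zE valLE (jet_interior fC nl')//.
  by rewrite -zE.
- have [d fd] := (fC.2 _ nl).1 ys v (etrans (size_rcons _ _) (congr1 S sz)) _ Rx.
  rewrite /iter_dderiv foldl_rcons; exact: (xgetPex 0 (ex_intro _ d fd)).
Qed.

Lemma regular_dense_jet R (n : nat) (x : R) (y : {ptws 'I_n -> X})
    (B : set (R * {ptws 'I_n -> X})) : regular_subset R ->
  nbhs (x, y) B -> exists2 x' : R, R° (val x') & B (x', y).
Proof.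
move=> regR [[A C] /= [nA nC] AC].
have [W [oW Wx WA]] : exists W, [/\ open W, W (val x) & val @^-1` W `<=` A].
  by case: nA => _ [[W oW <-] Wx WA]; exists W.
have [z [Rz Wz]] := regR _ (set_mem (valP x)) _ (open_nbhs_nbhs (conj oW Wx)).
exists (SigSub (mem_set (interior_subset Rz))) => //.
by apply: AC; split; [exact: WA|exact: nbhs_singleton].
Qed.

Lemma djet_ext_unique R (f : R -> Y) (n : nat) g h : hausdorff_space Y ->
  regular_subset R -> djet_ext f (j := n) g -> djet_ext f h -> g = h.
Proof.
move=> hY regR [cg gE] [ch hE]; apply/funext => -[x y]; apply: hY => A B nA nB.
have nAB : nbhs (x, y) (g @^-1` A `&` h @^-1` B).
  by apply: filterI; [exact: cg|exact: ch].
have [x' Rx' [Ax' Bx']] := regular_dense_jet regR nAB.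
exists (g (x', y)); split=> //; rewrite gE// -hE//; exact: Bx'.
Qed.

Lemma djet_map_unique R (f : R -> Y) (n : nat) g : hausdorff_space Y ->
  regular_subset R -> djet_ext f (j := n) g -> djet_map f n = g.
Proof.
move=> hY regR fg; apply: (djet_ext_unique hY regR _ fg).
exact: (xgetPex (fun=> 0) (ex_intro _ g fg)).
Qed.

Lemma jet0 R (f : R -> Y) (x : R) ys : hausdorff_space Y ->
  regular_subset R -> continuous f -> jet f 0 x ys = f x.
Proof.
move=> hY regR cf; rewrite /jet (@djet_map_unique _ _ _ (fun p => f p.1))//.
split; first by move=> p; apply: continuous_comp; [exact: cvg_fst|exact: cf].
move=> z y Rz; rewrite /djet (size0nil (s := codom y)) ?size_codom ?card_ord//=.
exact: (esym (valLE f z)).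
Qed.

End jets.
Arguments jet {K X Y R} f n x ys.

Section Cspace_topology.
Context {K : realType} {X Y : lcsType K} {R : set X} {l : smoothness}.
Implicit Types f g : Cspace l R Y.

Lemma Cspace_sub f g :
  (f - g : Cspace l R Y) = (f : R -> Y) - (g : R -> Y) :> (R -> Y).
Proof. by []. Qed.

Lemma Cspace_scale (a : K) f :
  (a *: f : Cspace l R Y) = a *: (f : R -> Y) :> (R -> Y).
Proof. by []. Qed.

Lemma Cspace_cvgP (F : set_system (Cspace l R Y)) f : Filter F ->
  F --> f <-> forall n, le_smooth n l ->
    (fun g => djet_map g n : {compact-open, _ -> Y}) @ F -->
      (djet_map f n : {compact-open, _ -> Y}).
Proof.
move=> FF; split.
  move=> /cvg_sup Ff n nl; have {}Ff := Ff (exist _ n nl).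
  move=> A nA; apply: Ff.
  exact: (initial_continuous (f := fun g : Cspace l R Y => djet_map g n : {compact-open, _ -> Y}) nA).
move=> Ff; apply/cvg_sup => -[n nl] A [B [[W oW WB] Bf BA]].
rewrite /=; apply: filterS BA _; rewrite -WB.
apply: (Ff n nl); apply: open_nbhs_nbhs; split=> //.
by move: Bf; rewrite -WB.
Qed.

End Cspace_topology.

Section extension_by_zero.
Context {K : realType} {X Y : lcsType K} {R : set X}.
Implicit Types f g : R -> Y.

Lemma valL_cvg_within f (x : R) : {for x, continuous f} ->
  'valL_ 0 f @ within R (nbhs (val x)) --> f x.
Proof.
move=> cf U /cf[_ [[W oW <-] Wx WU]]; rewrite /fmap/= /within/=.
apply: filterS (open_nbhs_nbhs (conj oW Wx)) => z Wz Rz.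
change (U ('valL_ 0 f z)); rewrite (valL_at f Rz); exact: (WU (SigSub (mem_set Rz))).
Qed.

Lemma valL_continuous_interior f (x : R) : R° (val x) -> {for x, continuous f} ->
  {for val x, continuous ('valL_ 0 f)}.
Proof.
move=> Rx /valL_cvg_within fx; rewrite /continuous_at.
by rewrite within_interior in fx; last exact: Rx; move=> U; rewrite [X in nbhs X](valLE f x); exact: fx.
Qed.

Lemma continuous_eq_interior f g : regular_subset R ->
  continuous f -> continuous g -> (forall x : R, R° (val x) -> f x = g x) ->
  f = g.
Proof.
move=> regR cf cg fg; apply/funext => x; apply: (@lcs_hausdorff K Y) => A B nA nB.
have [_ [[W oW <-] Wx WAB]] : nbhs x (f @^-1` A `&` g @^-1` B).
  by apply: filterI; [exact: cf|exact: cg].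
have [z [Rz Wz]] := regR _ (set_mem (valP x)) _ (open_nbhs_nbhs (conj oW Wx)).
pose z' : R := SigSub (mem_set (interior_subset Rz)).
have [Az Bz] := WAB z' Wz.
by exists (f z'); split=> //; rewrite fg.
Qed.

End extension_by_zero.

Section jet_linearity.
Context {K : realType} {X Y : lcsType K} {R : set X} {l : smoothness}.
Hypothesis regR : regular_subset R.
Implicit Types f g : R -> Y.

Lemma djet_map_lin (a : K) f g (n : nat) : isC l f -> isC l g -> le_smooth n l ->
  djet_map (a *: f + g) n = fun p => a *: djet_map f n p + djet_map g n p.
Proof.
move=> fC gC nl; have [cf fE] := djet_mapP fC nl; have [cg gE] := djet_mapP gC nl.
apply: (djet_map_unique (@lcs_hausdorff K Y) regR); split.
  by move=> p; apply: cvg_add; [apply: cvg_scale; exact: cf|exact: cg].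
move=> x y Rx; rewrite fE// gE// /djet.
symmetry; apply: (iter_dderiv_lin (@open_interior _ R) (n := n)) => //.
- by move=> z /interior_subset; exact: valL_lin.
- exact: isC_iter_derivable fC nl.
- exact: isC_iter_derivable gC nl.
- by rewrite size_codom card_ord.
Qed.

Lemma jet_lin (a : K) f g (n : nat) x ys : isC l f -> isC l g -> le_smooth n l ->
  jet (a *: f + g) n x ys = a *: jet f n x ys + jet g n x ys.
Proof. by move=> fC gC nl; rewrite /jet djet_map_lin. Qed.

Lemma jet_scale (a : K) f (n : nat) x ys : isC l f -> le_smooth n l ->
  jet (a *: f) n x ys = a *: jet f n x ys.
Proof.
move=> fC nl; have C0 : isC l (0 : R -> Y) by have [/asboolP] := @isC_submod_closed K X Y R l.
have := jet_lin (-1) x ys C0 C0 nl; rewrite scaler0 addr0 scaleN1r addNr => J0.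
by have := jet_lin a x ys fC C0 nl; rewrite addr0 J0 addr0.
Qed.

Lemma jet_sub f g (n : nat) x ys : isC l f -> isC l g -> le_smooth n l ->
  jet (f - g) n x ys = jet f n x ys - jet g n x ys.
Proof.
move=> fC gC nl; have := jet_lin (-1) x ys gC fC nl.
by rewrite !scaleN1r addrC => ->; rewrite addrC.
Qed.

Lemma djet_map_jet f (n : nat) (p : R * {ptws 'I_n -> X}) :
  djet_map f n p = jet f n p.1 (codom p.2).
Proof.
case: p => x y; rewrite /jet /=; congr (djet_map f n (x, _)).
apply/funext => i; rewrite codomE (nth_map i) ?size_enum_ord//.
by congr (y _); apply: val_inj; rewrite /= nth_enum_ord.
Qed.

Lemma djet_map_scale_sub (a : K) f g (n : nat) : isC l (f - g) ->
  isC l f -> isC l g -> le_smooth n l ->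
  djet_map (a *: (f - g)) n = fun p => a *: (djet_map f n p - djet_map g n p).
Proof.
move=> fgC fC gC nl; apply/funext => p; rewrite !djet_map_jet.
by rewrite jet_scale// jet_sub.
Qed.

End jet_linearity.

Section Cspace_evaluation.
Context {K : realType} {X Y : lcsType K} {R : set X} {l : smoothness}.
Hypothesis regR : regular_subset R.
Implicit Types f g : Cspace l R Y.

Lemma Cspace_jet_cvg (T : Type) (F : set_system T) (q : T -> Cspace l R Y) f
    (n : nat) x ys : Filter F -> le_smooth n l -> q @ F --> f ->
  (fun t => jet (q t) n x ys) @ F --> jet f n x ys.
Proof.
move=> FF nl /Cspace_cvgP/(_ _ nl)/compact_open_cvgP qf U.
rewrite nbhsE => -[Q [oQ Qfx] QU].
have H := qf [set (x, fun i : 'I_n => nth 0 ys i)] Q (@compact_set1 _ _) oQ.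
have {}H : F [set t | djet_map (q t) n @` [set (x, fun i : 'I_n => nth 0 ys i)] `<=` Q].
  by apply: H => _ [_ -> <-].
change (F [set t | U (jet (q t) n x ys)]); apply: filterS H => t tQ.
by apply: QU; apply: tQ; exists (x, fun i : 'I_n => nth 0 ys i).
Qed.

Lemma Cspace_eval_cvg (T : Type) (F : set_system T) (q : T -> Cspace l R Y) f x :
  Filter F -> q @ F --> f -> (fun t => q t x) @ F --> f x.
Proof.
move=> FF qf; have l0 : le_smooth 0 l by case: (l).
have H := @Cspace_jet_cvg _ _ q f 0 x [::] FF l0 qf.
have ev (g : Cspace l R Y) : jet g 0 x [::] = g x.
  by apply: jet0 => //; [exact: lcs_hausdorff|exact: (CspaceP g).1].
by move: H; rewrite ev; under eq_fun do rewrite ev.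
Qed.

Lemma Cspace_hausdorff : hausdorff_space (Cspace l R Y).
Proof.
move=> f g fg; suff fgE : (f : R -> Y) = g by apply: val_inj.
apply/funext => x; apply: (@lcs_hausdorff K Y) => A B nA nB.
have := fg ((fun h : Cspace l R Y => h x) @^-1` A) ((fun h : Cspace l R Y => h x) @^-1` B).
case.
- exact: (@Cspace_eval_cvg _ (nbhs f) id f x _ (@cvg_id _ _) _ nA).
- exact: (@Cspace_eval_cvg _ (nbhs g) id g x _ (@cvg_id _ _) _ nB).
by move=> h [Ah Bh]; exists (h x).
Qed.

(** The form in which k-continuity of evaluation is used: map, base point and directions may all
    move, provided that they are parametrized by a compact space. *)
Lemma Cspace_jet_evaluation (P : topologicalType) (F : set_system P)
    (q : P -> Cspace l R Y) f (n : nat) (r : P -> R) (u : P -> seq X) (p : P) :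
  compact [set: P] -> Filter F -> F --> p -> le_smooth n l ->
  q @ F --> f -> continuous r ->
  (forall i, (i < n)%N -> continuous (fun t => nth 0 (u t) i)) ->
  (fun t => jet (q t) n (r t) (u t)) @ F --> jet f n (r p) (u p).
Proof.
move=> cP FF Fp nl /Cspace_cvgP/(_ _ nl) qf cr cu.
pose c t : R * {ptws 'I_n -> X} := (r t, fun i : 'I_n => nth 0 (u t) i).
have cc : continuous c.
  move=> t U [[A B] /= [nA nB] AB].
  have nA' : nbhs t (r @^-1` A) by exact: cr.
  have uB := @pointwise_nth_cvg K X _ (nbhs t) n u (u t) _ (fun i ltin => cu i ltin t).
  have nB' : nbhs t [set t | B (fun i : 'I_n => nth 0 (u t) i)] by exact: uB.
  by apply: filterS2 nA' nB' => t' At Bt; apply: (AB (_, _)).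
exact: (compact_open_evaluation (@uniform_regular Y) cP cc
  (djet_mapP (CspaceP f) nl).1 FF Fp qf).
Qed.

End Cspace_evaluation.

(** * Multilinearity and symmetry of iterated derivatives *)

Lemma le_smoothW (i j : nat) (l : smoothness) :
  (i <= j)%N -> le_smooth j l -> le_smooth i l.
Proof. by case: l => //= n; exact: leq_trans. Qed.

Section directions.
Context {K : realType} {X Y : lcsType K}.
Implicit Types (R : set X) (f : X -> Y).

Lemma plane_cvg (x v w : X) :
  (fun p : K * K => x + p.1 *: v + p.2 *: w) @ (0, 0) --> x.
Proof.
have -> : nbhs x = nbhs (x + 0 *: v + 0 *: w) by rewrite !scale0r !addr0.
apply: cvg_add; first apply: cvg_add.
- exact: cvg_cst.
- by apply: cvg_scalel; [exact: cvg_fst|exact: cvg_cst].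
- by apply: cvg_scalel; [exact: cvg_snd|exact: cvg_cst].
Qed.

Lemma has_dderivZ f (x e : X) (a : K) (d : Y) :
  has_dderiv f x e d -> has_dderiv f x (a *: e) (a *: d).
Proof.
have [->|a0] := eqVneq a 0.
  move=> _; rewrite !scale0r /has_dderiv.
  under eq_fun do rewrite scaler0 addr0 subrr scaler0.
  exact: cvg_cst.
move=> fd; pose q (h : K) := h^-1 *: (f (x + h *: e) - f x).
have cm : (fun h : K => h * a) @ 0^' --> (0 : K)^'.
  move=> U /near_abs_lt[d' d0 dU].
  have nd : \forall h \near (0 : K), `|h| < d' / `|a|.
    by apply/near_abs_lt; exists (d' / `|a|); rewrite ?divr_gt0 ?normr_gt0.
  change (\forall h \near (0 : K), h != 0 -> U (h * a)).
  apply: filterS nd => h hd h0; apply: dU; last by rewrite mulf_neq0.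
  by rewrite normrM -ltr_pdivlMr ?normr_gt0.
have H : (fun h => a *: q (h * a)) @ 0^' --> a *: d.
  by apply: cvg_scale; exact: (cvg_comp _ _ cm fd).
apply: (cvg_trans _ H); apply: near_eq_cvg; apply: nearW => h /=.
rewrite [h *: (a *: e)]scalerA /q [a *: _]scalerA; congr (_ *: _).
by rewrite invfM mulrCA divff// mulr1.
Qed.

Lemma has_dderiv_lin_dir f (g : X -> Y) (x e e' : X) (a : K) (d : Y) (U : set X) :
  open U -> U x -> (forall z, U z -> has_dderiv f z e' (g z)) ->
  {for (0, 0), continuous (fun p : K * K => g (x + p.1 *: (a *: e) + p.2 *: e'))} ->
  has_dderiv f x e d -> has_dderiv f x (a *: e + e') (a *: d + g x).
Proof.
move=> oU Ux fg cg /(has_dderivZ (a := a)); apply: has_dderivD => //.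
have nU : \forall p \near ((0, 0) : K * K), U (x + p.1 *: (a *: e) + p.2 *: e').
  exact: (@plane_cvg x (a *: e) e' U (open_nbhs_nbhs (conj oU Ux))).
by apply: filterS nU => p; exact: fg.
Qed.

End directions.

Section symmetric_derivatives.
Context {K : realType} {X Y : lcsType K}.
Variables (U : set X) (phi : X -> Y) (l : smoothness).
Hypothesis oU : open U.
Hypothesis dphi : forall (ys : seq X) (v x : X), le_smooth (size ys).+1 l -> U x ->
  has_dderiv (iter_dderiv ys phi) x v (iter_dderiv (rcons ys v) phi x).
Hypothesis cphi : forall (ys : seq X) (x v w : X), le_smooth (size ys) l -> U x ->
  {for (0, 0), continuous (fun p : K * K =>
    iter_dderiv ys phi (x + p.1 *: v + p.2 *: w))}.

(** Linearity in the direction applied last is [has_dderiv_lin_dir]; it holds on all of [U], so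
    differentiation along [vs] preserves it. Continuity along planes is the form of [cphi] because
    k-continuity of the derivatives of [zeta] supplies it, on compact squares of parameters. *)
Lemma iter_dderiv_slot (us vs : seq X) (a : K) (e e' : X) x :
  le_smooth (size us + (size vs).+1) l -> U x ->
  iter_dderiv (us ++ (a *: e + e') :: vs) phi x =
  a *: iter_dderiv (us ++ e :: vs) phi x + iter_dderiv (us ++ e' :: vs) phi x.
Proof.
move=> nl Ux.
have catE c : iter_dderiv (us ++ c :: vs) phi = iter_dderiv vs (iter_dderiv (rcons us c) phi).
  by rewrite -cat_rcons /iter_dderiv foldl_cat.
have der c : iter_derivable U (size vs) (iter_dderiv (rcons us c) phi).
  move=> ys y lty z Uz; exists (iter_dderiv (rcons (rcons us c ++ ys) y) phi z).
  rewrite /iter_dderiv -foldl_cat; apply: dphi => //.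
  by apply: le_smoothW nl; rewrite size_cat size_rcons addSn -!addnS leq_add2l ltnS.
have nl' : le_smooth (size us).+1 l.
  by apply: le_smoothW nl; rewrite addnS ltnS leq_addr.
rewrite !catE; apply: (iter_dderiv_lin oU (n := size vs)) => // z Uz.
rewrite {1}/iter_dderiv foldl_rcons; apply: dderivP.
apply: (has_dderiv_lin_dir oU) => //.
- by move=> w Uw; exact: dphi.
- by apply: cphi; rewrite ?size_rcons.
- exact: dphi.
Qed.

(** Schwarz's theorem exchanges [v] and [w] on all of [U]. Functions that agree on an open set have
    the same [iter_dderiv] along [vs] there, default values included. *)
Lemma iter_dderiv_swap (us vs : seq X) (v w : X) x :
  le_smooth (size us).+2 l -> U x ->
  iter_dderiv (us ++ v :: w :: vs) phi x = iter_dderiv (us ++ w :: v :: vs) phi x.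
Proof.
move=> nl Ux.
have catE c d : us ++ c :: d :: vs = rcons (rcons us c) d ++ vs by rewrite !cat_rcons.
rewrite !catE /iter_dderiv !foldl_cat; apply: iter_dderiv_eq_open Ux => // z Uz.
rewrite -!/(iter_dderiv _ _).
have nU : \forall p \near ((0, 0) : K * K), U (z + p.1 *: v + p.2 *: w).
  exact: (@plane_cvg K X z v w U (open_nbhs_nbhs (conj oU Uz))).
have nl' : le_smooth (size us).+1 l by exact: le_smoothW nl.
have shiftE (s t : K) : z + s *: v + t *: w = z + t *: w + s *: v by rewrite addrAC.
have := @mixed_partials_eq K Y
  (fun s t => iter_dderiv us phi (z + s *: v + t *: w))
  (fun s t => iter_dderiv (rcons us v) phi (z + s *: v + t *: w))
  (fun s t => iter_dderiv (rcons us w) phi (z + s *: v + t *: w))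
  (fun s t => iter_dderiv (rcons (rcons us v) w) phi (z + s *: v + t *: w))
  (fun s t => iter_dderiv (rcons (rcons us w) v) phi (z + s *: v + t *: w)).
rewrite !scale0r !addr0; apply.
- apply: filterS nU => -[s t] /= Ust.
  have Uts : U (z + t *: w + s *: v) by rewrite -shiftE.
  split.
  + rewrite /curve_deriv; under eq_fun do rewrite shiftE; rewrite shiftE.
    apply/(has_dderiv_line (iter_dderiv us phi)).
    by apply: dphi.
  + by apply/(has_dderiv_line (iter_dderiv (rcons us v) phi)); apply: dphi; rewrite ?size_rcons.
  + by apply/(has_dderiv_line (iter_dderiv us phi)); exact: dphi.
  + rewrite /curve_deriv; under eq_fun do rewrite shiftE; rewrite shiftE.
    apply/(has_dderiv_line (iter_dderiv (rcons us w) phi)).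
    by apply: dphi; rewrite ?size_rcons.
- by apply: cphi; rewrite ?size_rcons.
- by apply: cphi; rewrite ?size_rcons.
Qed.

End symmetric_derivatives.

Section multilinearity.
Context {K : realType} {X Y : lcsType K}.
Variables (R : set X) (l : smoothness) (F : R -> Y).
Hypotheses (regR : regular_subset R) (FC : isC l F).

Lemma has_dderiv_iter (ys : seq X) v x : le_smooth (size ys).+1 l -> R° x ->
  has_dderiv (iter_dderiv ys ('valL_ 0 F)) x v
    (iter_dderiv (rcons ys v) ('valL_ 0 F) x).
Proof.
move=> nl Rx; have [d fd] := (FC.2 _ nl).1 ys v (size_rcons _ _) x Rx.
by rewrite /iter_dderiv foldl_rcons; exact: (xgetPex 0 (ex_intro _ d fd)).
Qed.

Lemma jet_continuous (n : nat) ys : le_smooth n l ->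
  continuous (fun x => jet F n x ys).
Proof.
move=> nl x; apply: (@jet_cvg _ _ _ R l F n R (nbhs x) id (fun=> ys)) => //.
by move=> i _; exact: cvg_cst.
Qed.

Lemma iter_dderiv_continuous (ys : seq X) x : le_smooth (size ys) l -> R° x ->
  {for x, continuous (iter_dderiv ys ('valL_ 0 F))}.
Proof.
move=> nl Rx; pose x' : R := SigSub (mem_set (interior_subset Rx)).
have c1 := valL_continuous_interior (x := x') Rx (@jet_continuous (size ys) ys nl x').
have E z : R° z ->
    iter_dderiv ys ('valL_ 0 F) z = 'valL_ 0 (fun x => jet F (size ys) x ys) z.
  by move=> Rz; rewrite (valL_at _ (interior_subset Rz)) (jet_interior FC).
move=> U; change (nbhs (iter_dderiv ys ('valL_ 0 F) x) U ->
  nbhs x (iter_dderiv ys ('valL_ 0 F) @^-1` U)).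
rewrite (E x Rx) => /c1 nU.
have nR : nbhs x R° by apply: open_nbhs_nbhs; split=> //; exact: open_interior.
have nU' : nbhs x ('valL_ 0 (fun x => jet F (size ys) x ys) @^-1` U) by exact: nU.
by apply: filterS2 nU' nR => z Uz Rz; rewrite /preimage /mkset (E z Rz).
Qed.

(** [iter_dderiv_slot] settles interior points. Both sides are continuous in [x], and regularity of
    [R] carries the identity to the boundary. *)
Lemma jet_slot (n : nat) (us vs : seq X) (a : K) (e e' : X) (x : R) :
  le_smooth n l -> (size us + (size vs).+1)%N = n ->
  jet F n x (us ++ (a *: e + e') :: vs) =
  a *: jet F n x (us ++ e :: vs) + jet F n x (us ++ e' :: vs).
Proof.
move=> nl sz; pose rhs z := a *: jet F n z (us ++ e :: vs) + jet F n z (us ++ e' :: vs).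
suff : (fun z => jet F n z (us ++ (a *: e + e') :: vs)) = rhs by move=> /(congr1 (@^~ x)).
apply: continuous_eq_interior => //.
- exact: (@jet_continuous n _ nl).
- move=> z; exact: (cvg_add _ (cvg_scale _ (@jet_continuous n _ nl z))
    (@jet_continuous n _ nl z)).
move=> z Rz; rewrite /rhs !(jet_interior FC nl) ?size_cat//.
apply: (iter_dderiv_slot (@open_interior _ R) (l := l)) => //; last by rewrite sz.
  by move=> ys v y; exact: has_dderiv_iter.
move=> ys y v w yl Ry; have cy := iter_dderiv_continuous yl Ry.
rewrite /prop_for /continuous_at /= !scale0r !addr0.
exact: (cvg_comp _ _ (@plane_cvg K X y v w) cy).
Qed.

End multilinearity.

(** * Polarization *)

Section adjacent_swaps.
Variables (T : eqType) (W : Type) (L : seq T -> W) (n : nat).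
Hypothesis Lswap : forall us v w vs, (size us + (size vs).+2)%N = n ->
  L (us ++ v :: w :: vs) = L (us ++ w :: v :: vs).

Lemma swap_invariant_move pre x t1 t2 : (size pre + (size t1 + size t2).+1)%N = n ->
  L (pre ++ x :: t1 ++ t2) = L (pre ++ t1 ++ x :: t2).
Proof.
elim: t1 pre => [//|y t1 IH] pre sz; rewrite /= Lswap; last first.
  by rewrite -sz size_cat /= addSn.
rewrite -!(cat_rcons y); apply: IH.
by rewrite size_rcons -sz /= addSnnS.
Qed.

Lemma swap_invariant_perm s t : perm_eq s t -> size s = n -> L s = L t.
Proof.
move=> st sz; rewrite -[s]cat0s -[t]cat0s.
have : (size (Nil T) + size s)%N = n by [].
elim: s [::] t st {sz} => [|x s IH] pre t.
  by move/perm_size/esym/size0nil => ->.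
move=> st sz; have xt : x \in t by rewrite -(perm_mem st) mem_head.
case/splitPr: xt st => t1 t2 st.
have {}st : perm_eq s (t1 ++ t2).
  by move: st; rewrite perm_sym perm_catC /= perm_cons perm_catC perm_sym.
rewrite -cat_rcons (IH _ _ st); last by rewrite size_rcons addSnnS.
by rewrite cat_rcons swap_invariant_move// -size_cat -(perm_size st).
Qed.

End adjacent_swaps.

Section polarization.
Variables (K : realType).

(** Interpolation at the nodes 0, ..., m + 1: the weights read off the linear coefficient of a
    polynomial of degree at most m + 1. They solve a Vandermonde system, which is invertible since
    the nodes are distinct in [K]. *)
Lemma linear_coefficient_extraction (m : nat) : exists lam : 'I_m.+2 -> K,
  forall i : 'I_m.+2, \sum_t lam t * (t%:R : K) ^+ i = (i == 1 :> nat)%:R.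
Proof.
pose a : 'rV[K]_m.+2 := \row_t (t%:R : K).
have Vu : Vandermonde m.+2 a \in unitmx.
  rewrite unitmxE det_Vandermonde unitfE; apply/prodf_neq0 => i _.
  apply/prodf_neq0 => j ij; rewrite !mxE subr_eq0 eqr_nat.
  by rewrite gtn_eqF.
pose c := invmx (Vandermonde m.+2 a) *m \col_i ((i == 1 :> nat)%:R : K).
exists (fun t => c t ord0) => i.
have := mulKVmx Vu (\col_i ((i == 1 :> nat)%:R : K)); rewrite -/c.
move=> /matrixP/(_ i ord0); rewrite !mxE => <-.
by apply: eq_bigr => t _; rewrite !mxE mulrC.
Qed.

Variables (V W : lmodType K) (L : seq V -> W) (n : nat).
Hypothesis Lslot : forall us vs a e e', (size us + (size vs).+1)%N = n ->
  L (us ++ (a *: e + e') :: vs) = a *: L (us ++ e :: vs) + L (us ++ e' :: vs).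
Hypothesis Lswap : forall us v w vs, (size us + (size vs).+2)%N = n ->
  L (us ++ v :: w :: vs) = L (us ++ w :: v :: vs).

(** A binomial expansion of which only the linear coefficient is identified. Expanding one slot puts
    [u] or [v] in front of [post], so the induction has to quantify over [post]. *)
Lemma multilinear_line_expansion (m : nat) (u v : V) (post : seq V) :
  (m + size post)%N = n -> exists2 c : nat -> W,
    c 1%N = m%:R *: L (v :: nseq m.-1 u ++ post) &
    forall t : K, L (nseq m (u + t *: v) ++ post) = \sum_(i < m.+1) t ^+ i *: c i.
Proof.
elim: m post => [|m IH] post sz.
  exists (fun i => if i is 0 then L post else 0); first by rewrite scale0r.
  by move=> t; rewrite big_ord1 expr0 scale1r.
have [|cu cu1 cuE] := IH (u :: post); first by rewrite -sz addnS.
have [|cv cv1 cvE] := IH (v :: post); first by rewrite -sz addnS.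
(* Pascal's recursion. The guard discards [cu m.+1], which is not a coefficient of the expansion
   given by [cuE]. *)
pose c i := (if (i <= m)%N then cu i else 0) + (if i is i'.+1 then cv i' else 0).
exists c.
  have cv0 : cv 0%N = L (nseq m u ++ v :: post).
    have := cvE 0; rewrite scale0r addr0 => ->.
    by rewrite big_ord_recl expr0 scale1r big1 ?addr0// => i _; rewrite exprS mul0r scale0r.
  have permL s : perm_eq s (v :: nseq m u ++ post) -> L s = L (v :: nseq m u ++ post).
    move=> ps; apply: (swap_invariant_perm Lswap ps).
    by rewrite (perm_size ps) /= size_cat size_nseq -sz.
  rewrite /c cv0; have -> : (if (1 <= m)%N then cu 1%N else 0) =
      m%:R *: L (v :: nseq m u ++ post).
    case: m cu1 {IH cuE cvE cv0 cv1 sz c} permL => [|m] cu1 permL; first by rewrite scale0r.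
    rewrite cu1 /=; congr (_ *: _); apply: permL.
    by rewrite perm_cons -cat_rcons -cats1 -catA perm_catCA /=.
  rewrite (permL (nseq m u ++ v :: post)); last by rewrite -cat_rcons -cats1 -catA perm_catCA.
  by rewrite -[X in _ + X]scale1r -scalerDl -natr1.
move=> t.
have -> : L (nseq m.+1 (u + t *: v) ++ post) =
    t *: L (nseq m (u + t *: v) ++ v :: post) + L (nseq m (u + t *: v) ++ u :: post).
  rewrite -Lslot ?size_nseq; last by rewrite -sz addnS.
  rewrite [t *: v + u]addrC; congr L.
  by elim: (m) => //= m' ->.
rewrite cvE cuE /c.
under [RHS]eq_bigr do rewrite scalerDr.
rewrite big_split addrC /=; congr (_ + _).
  rewrite [RHS]big_ord_recr /= ltnn scaler0 addr0; apply: eq_bigr => i _.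
  by rewrite -ltnS ltn_ord.
rewrite [RHS]big_ord_recl scaler0 add0r scaler_sumr; apply: eq_bigr => i _.
by rewrite scalerA -exprS.
Qed.

End polarization.

(* [mu] extracts the coefficient of [t] from the polynomial
   [t |-> L (nseq m.+1 (u + t *: v) ++ post)] of degree [m + 1], evaluated at
   0, ..., m + 1. Only the coefficients [mu], and not the values of [L], occur,
   so that continuity on the diagonal propagates to all arguments. *)
Lemma polarization_step (K : realType) (m : nat) : exists mu : 'I_m.+2 -> K,
  forall (V W : lmodType K) (L : seq V -> W) (n : nat),
  (forall us vs a e e', (size us + (size vs).+1)%N = n ->
    L (us ++ (a *: e + e') :: vs) = a *: L (us ++ e :: vs) + L (us ++ e' :: vs)) ->
  (forall us v w vs, (size us + (size vs).+2)%N = n ->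
    L (us ++ v :: w :: vs) = L (us ++ w :: v :: vs)) ->
  forall u v post, (m.+1 + size post)%N = n ->
  L (nseq m u ++ v :: post) =
    \sum_t mu t *: L (nseq m.+1 (u + t%:R *: v) ++ post).
Proof.
have [lam lamE] := @linear_coefficient_extraction K m.
(* In the expansion with m + 1 equal slots, [v] can occupy any of them, and by symmetry all these
   contributions agree; hence the division by m + 1. *)
exists (fun t => (m.+1)%:R^-1 * lam t) => V W L n Lslot Lswap u v post sz.
have [c c1 cE] := multilinear_line_expansion Lslot Lswap u v sz.
have -> : L (nseq m u ++ v :: post) = L (v :: nseq m u ++ post).
  apply: (swap_invariant_perm Lswap).
    by rewrite -cat_rcons -cats1 -catA perm_catCA.
  by rewrite size_cat size_nseq /= addnS.
under eq_bigr do rewrite cE scaler_sumr.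
rewrite exchange_big /= (bigD1 (Ordinal (isT : (1 < m.+2)%N)))//= [X in _ + X]big1 ?addr0; last first.
  move=> i i1; under eq_bigr do rewrite scalerA -mulrA.
  rewrite -scaler_suml -mulr_sumr lamE.
  by rewrite (_ : (i == 1 :> nat) = false) ?mulr0 ?scale0r//; apply/negbTE.
under eq_bigr do rewrite scalerA -mulrA.
rewrite -scaler_suml -mulr_sumr (lamE (Ordinal (isT : (1 < m.+2)%N))) eqxx mulr1 c1.
by rewrite scalerA mulVf ?scale1r// pnatr_eq0.
Qed.

(** * Linear combinations of continuous maps into C^l(R, Y) *)

(** Compact-open convergence to a continuous limit is continuous convergence on each compact [C].
    This local joint form combines with continuity of addition and is then made uniform by covering
    [C]. *)
Lemma compact_open_cvg_near (T Y : topologicalType) (I : Type) (F : set_system I)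
    (q : I -> T -> Y) (f : T -> Y) (C : set T) (x : T) (U : set Y) :
  regular_space Y -> Filter F -> continuous f -> compact C ->
  (q @ F : set_system {compact-open, T -> Y}) --> (f : {compact-open, T -> Y}) ->
  nbhs (f x) U -> \forall y \near x & i \near F, C y -> U (q i y).
Proof.
move=> regY FF cf cC /compact_open_cvgP qf nU.
have [V nV VU] : exists2 V, nbhs (f x) V & closure V `<=` U°.
  apply: regY; apply: open_nbhs_nbhs; split=> //; exact: open_interior.
pose N := C `&` f @^-1` closure V.
have cN : compact N.
  by apply: compact_closedI => //; apply: closed_comp; [move=> y _; exact: cf|exact: closed_closure].
have FN : F [set i | q i @` N `<=` U°].
  apply: (qf _ _ cN (open_interior U)).
  by move=> _ [y [_ Vy] <-]; exact: VU.
exists (f @^-1` V, [set i | q i @` N `<=` U°]); first by split=> //; exact: cf.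
move=> -[y i] /= [Vy qiN] Cy; apply: (@interior_subset _ U); apply: qiN.
by exists y => //; split=> //; exact: subset_closure.
Qed.

Lemma compact_open_cvg_lin (K : realType) (T : topologicalType) (Y : lcsType K)
    (I : Type) (F : set_system I) (q r : I -> T -> Y) (f g : T -> Y) (a : K) :
  Filter F -> continuous f -> continuous g ->
  (q @ F : set_system {compact-open, T -> Y}) --> (f : {compact-open, T -> Y}) ->
  (r @ F : set_system {compact-open, T -> Y}) --> (g : {compact-open, T -> Y}) ->
  ((fun i x => a *: q i x + r i x) @ F : set_system {compact-open, T -> Y}) -->
    ((fun x => a *: f x + g x) : {compact-open, T -> Y}).
Proof.
move=> FF cf cg qf rg; apply/compact_open_cvgP => C Q cC oQ CQ.
have /compact_near_coveringP/near_covering_withinP := cC.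
move=> /(_ I F (fun i x => Q (a *: q i x + r i x)) FF) cov.
have {}cov : F [set i | C `<=` (fun x => Q (a *: q i x + r i x))].
  apply: cov => x Cx.
  have : nbhs (a *: f x + g x) Q by apply: open_nbhs_nbhs; split=> //; apply: CQ; exists x.
  have cl : (fun p : Y * Y => a *: p.1 + p.2) @ (f x, g x) --> a *: f x + g x.
    exact: (cvg_add _ (cvg_scale _ (@cvg_fst _ _ (nbhs (f x)) (nbhs (g x)) _))
      (@cvg_snd _ _ (nbhs (f x)) (nbhs (g x)) _)).
  move=> /cl[[U1 U2] /= [nU1 nU2] U12].
  have H1 := compact_open_cvg_near (@uniform_regular Y) FF cf cC qf nU1.
  have H2 := compact_open_cvg_near (@uniform_regular Y) FF cg cC rg nU2.
  apply: filterS2 H1 H2 => -[y i] /= Uq Ur Cy.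
  by apply: (U12 (_, _)); split; [exact: Uq|exact: Ur].
change (F [set i | [set a *: q i x + r i x | x in C] `<=` Q]).
by apply: filterS cov => i CQi _ [x Cx <-]; exact: CQi.
Qed.

Section Cspace_continuity.
Context {K : realType} {X Y : lcsType K} {R : set X} {l : smoothness}.
Hypothesis regR : regular_subset R.

(** [Cspace] carries a module structure and a topology that are not linked by axioms, so the
    compatibility needed for polarization sums is derived here, one order of differentiation at a
    time. *)
Lemma Cspace_continuous_lin (P : topologicalType) (f g : P -> Cspace l R Y) (a : K) :
  continuous f -> continuous g -> continuous (fun p => a *: f p + g p).
Proof.
move=> cf cg p; apply/Cspace_cvgP => n nl.
have Hf : (fun q => djet_map (f q) n : {compact-open, _ -> Y}) @ p -->
    (djet_map (f p) n : {compact-open, _ -> Y}).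
  exact: ((Cspace_cvgP (f p) _).1 (cf p) n nl).
have Hg : (fun q => djet_map (g q) n : {compact-open, _ -> Y}) @ p -->
    (djet_map (g p) n : {compact-open, _ -> Y}).
  exact: ((Cspace_cvgP (g p) _).1 (cg p) n nl).
have H := @compact_open_cvg_lin K _ Y P (nbhs p) _ _ _ _ a _
  (djet_mapP (CspaceP (f p)) nl).1 (djet_mapP (CspaceP (g p)) nl).1 Hf Hg.
have E q : djet_map (a *: f q + g q) n =
    fun x => a *: djet_map (f q) n x + djet_map (g q) n x.
  exact: (djet_map_lin regR a (CspaceP (f q)) (CspaceP (g q)) nl).
move=> U nU; have HU := H (nbhs_filter p) U; rewrite -E in HU.
change (nbhs p [set q | U (djet_map (a *: f q + g q : Cspace l R Y) n)]).
have -> : (fun q => U (djet_map (a *: f q + g q : Cspace l R Y) n)) =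
    (fun q => U (fun x => a *: djet_map (f q) n x + djet_map (g q) n x)).
  by apply/funext => q; rewrite E.
exact: HU nU.
Qed.

Lemma Cspace_continuous_sum (P : topologicalType) (I : Type) (s : seq I)
    (f : I -> P -> Cspace l R Y) (a : I -> K) :
  (forall i, continuous (f i)) -> continuous (fun p => \sum_(i <- s) a i *: f i p).
Proof.
move=> cf; elim: s => [|i s IH].
  by under eq_fun do rewrite big_nil; exact: cst_continuous.
under eq_fun do rewrite big_cons; exact: Cspace_continuous_lin.
Qed.

End Cspace_continuity.

(** * Chain rule *)

Definition curve_deriv0 (K : realType) (Y : lcsType K) (phi : K -> Y) (d : Y) : Prop :=
  (fun h : K => h^-1 *: (phi h - phi 0)) @ 0^' --> d.

Lemma curve_deriv0_cvg (K : realType) (Y : lcsType K) (phi : K -> Y) (d : Y) :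
  curve_deriv0 phi d -> phi @ 0^' --> phi 0.
Proof.
move=> dphi; have h0 : (fun h : K => h) @ 0^' --> (0 : K) by exact: cvg_within.
have H : (fun h => h *: (h^-1 *: (phi h - phi 0)) + phi 0) @ 0^' --> 0 *: d + phi 0.
  by apply: cvg_add; [exact: cvg_scalel|exact: cvg_cst].
rewrite scale0r add0r in H; apply: (cvg_trans _ H); apply: near_eq_cvg.
apply: filterS (@nbhs_dnbhs_neq _ (0 : K)) => h hn0.
by rewrite scalerA mulfV// scale1r subrK.
Qed.

Section slots.
Context {K : realType} {E F : lcsType K} {T : eqType}.
Variables (M : seq E -> F) (v : T -> K -> E) (v' : T -> E).

(** The sum of Leibniz's rule at 0 for [M] applied to the curves [v b]; [pre] collects the slots
    already passed. *)
Fixpoint slot_sum (pre : seq E) (bs : seq T) : F :=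
  if bs is b :: bs' then
    M (pre ++ v' b :: [seq v c 0 | c <- bs']) + slot_sum (rcons pre (v b 0)) bs'
  else 0.

(** The increment telescopes over the slots. When slot [b] changes, the slots before it are at 0 and
    those after it still at [h], so joint continuity of [M] is what yields the limit. *)
Lemma slots_deriv (n : nat) (pre : seq E) (bs : seq T) :
  (forall us a e e' vs, (size us + (size vs).+1)%N = n ->
    M (us ++ (a *: e + e') :: vs) = a *: M (us ++ e :: vs) + M (us ++ e' :: vs)) ->
  (forall (u : K -> seq E) us,
    (forall i, (i < n)%N -> (fun h => nth 0 (u h) i) @ 0^' --> nth 0 us i) ->
    (fun h => M (u h)) @ 0^' --> M us) ->
  {in bs, forall b, curve_deriv0 (v b) (v' b)} ->
  (size pre + size bs)%N = n ->
  curve_deriv0 (fun h => M (pre ++ [seq v b h | b <- bs])) (slot_sum pre bs).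
Proof.
move=> Mlin Mcont; elim: bs pre => [|b bs IH] pre dv sz /=.
  by rewrite /curve_deriv0; under eq_fun do rewrite subrr scaler0; exact: cvg_cst.
have db : curve_deriv0 (v b) (v' b) by apply: dv; rewrite mem_head.
have {}IH := IH (rcons pre (v b 0)).
have {IH} H2 : curve_deriv0 (fun h => M (rcons pre (v b 0) ++ [seq v b h | b <- bs]))
    (slot_sum (rcons pre (v b 0)) bs).
  apply: IH; last by rewrite size_rcons addSn -addnS.
  by move=> c cbs; apply: dv; rewrite in_cons cbs orbT.
have H1 : (fun h => M (pre ++ (h^-1 *: (v b h - v b 0)) :: [seq v c h | c <- bs])) @ 0^'
    --> M (pre ++ v' b :: [seq v c 0 | c <- bs]).
  apply: Mcont => i ltin; rewrite nth_cat.
  under eq_fun do rewrite nth_cat.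
  case: ifP => [_|]; first exact: cvg_cst.
  move=> ni; case jE: (i - size pre)%N => [|j] /=; first exact: db.
  have lepi : (size pre <= i)%N by rewrite leqNgt ni.
  have ltj : (j < size bs)%N.
    have szE : (size pre + (size bs).+1)%N = n := sz.
    rewrite -ltnS; have <- : (i - size pre)%N = j.+1 := jE.
    by rewrite ltn_subLR// szE.
  rewrite (nth_map b)//; under eq_fun do rewrite (nth_map b)//.
  apply: curve_deriv0_cvg; apply: (dv (nth b bs j)).
  by rewrite in_cons mem_nth ?orbT.
apply: (cvg_trans _ (cvg_add _ H1 H2)); apply: near_eq_cvg; apply: nearW => h.
have Mdiff us e e' vs : (size us + (size vs).+1)%N = n ->
    M (us ++ (h^-1 *: (e - e')) :: vs) = h^-1 *: (M (us ++ e :: vs) - M (us ++ e' :: vs)).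
  move=> szu; have M0 : M (us ++ 0 :: vs) = 0.
    by have := Mlin us (-1) 0 0 vs szu; rewrite scaler0 addr0 scaleN1r addNr.
  have := Mlin us h^-1 (e - e') 0 vs szu; rewrite addr0 M0 addr0 => ->.
  by have := Mlin us (-1) e' e vs szu; rewrite scaleN1r addrC => ->; rewrite scaleN1r addrC.
rewrite Mdiff ?size_map// -scalerDr !cat_rcons; congr (_ *: _).
by rewrite addrA subrK.
Qed.

End slots.

Section chain_rule.
Context {K : realType} {E F : lcsType K} {S : set E} {m : smoothness}.
Hypotheses (lcS : locally_convex_subset S) (regS : regular_subset S).

(** The base point ranges over all of [E], so that a curve lying in [S] only for small [h] can be
    inserted. *)
Definition ajet (f : S -> F) (n : nat) (s : E) (us : seq E) : F :=
  'valL_ 0 (fun s : S => jet f n s us) s.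

Lemma ajetE (f : S -> F) n (s : S) us : ajet f n (val s) us = jet f n s us.
Proof. exact: valLE. Qed.

Variables (f : S -> F).
Hypothesis fC : isC m f.

(** The increment splits in two. The base point moves while the directions stay at [h]: this is
    [difference_quotient_near] with the directions as parameter, valid also at boundary points of
    [S]. Then the directions move at the fixed base point [e 0]: this is Leibniz's rule. *)
Lemma jet_chain_rule (T : eqType) (v : T -> K -> E) (v' : T -> E) (n : nat)
    (e : K -> E) (e' : E) (bs : seq T) :
  le_smooth n.+1 m -> size bs = n ->
  S (e 0) -> (\forall h \near (0 : K), S (e h)) -> curve_deriv0 e e' ->
  {in bs, forall b, curve_deriv0 (v b) (v' b)} ->
  curve_deriv0 (fun h => ajet f n (e h) [seq v b h | b <- bs])
    (ajet f n.+1 (e 0) (rcons [seq v b 0 | b <- bs] e') +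
     slot_sum (ajet f n (e 0)) v v' [::] bs).
Proof.
move=> nm sz Se0 Se de dv; have nm' : le_smooth n m by exact: le_smoothW nm.
pose s0 : S := SigSub (mem_set Se0).
pose vs h := [seq v b h | b <- bs].
have aE us : ajet f n (e 0) us = jet f n s0 us by exact: (ajetE f n s0 us).
have H2 : curve_deriv0 (fun h => ajet f n (e 0) (vs h)) (slot_sum (ajet f n (e 0)) v v' [::] bs).
  apply: (@slots_deriv _ _ _ _ (ajet f n (e 0)) v v' n [::]) => //.
    by move=> us a u u' ws szu; rewrite !aE; exact: (jet_slot regS fC _ _ _ s0 nm' szu).
  move=> u us cu; rewrite aE; under eq_fun do rewrite aE.
  by apply: (jet_cvg _ fC) => //; exact: cvg_cst.
pose P := {ptws 'I_n -> E}.
pose u h : P := fun i => nth 0 (vs h) i.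
have codomu h : codom (u h) = vs h by rewrite codom_nth// size_map.
have cu : u @ 0^' --> u 0.
  apply: pointwise_nth_cvg => i ltin.
  have [b0 _] : exists b : T, True by case: (bs) sz ltin => [<-//|b *]; exists b.
  rewrite (nth_map b0) ?sz//; under eq_fun do rewrite (nth_map b0) ?sz//.
  by apply: curve_deriv0_cvg; apply: dv; rewrite mem_nth ?sz.
pose Phi (s : E) (w : P) := ajet f n s (codom w).
pose DPhi (s : E) (w : P) (d : E) := ajet f n.+1 s (rcons (codom w) d).
have dPhi s w d : S° s -> has_dderiv (Phi ^~ w) s d (DPhi s w d).
  move=> Ss; pose s' : S := SigSub (mem_set (interior_subset Ss)).
  rewrite /DPhi -[s]/(val s') ajetE.
  have szw : size (codom w) = n by rewrite size_codom card_ord.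
  exact: (@has_dderiv_jet _ _ _ S m f n s' (codom w) d fC nm szw Ss).
have cPhi s w : S s -> (Phi ^~ w) @ within S (nbhs s) --> Phi s w.
  move=> Ss; pose s' : S := SigSub (mem_set Ss).
  rewrite /Phi -[s]/(val s') ajetE.
  by apply: valL_cvg_within; exact: (@jet_continuous _ _ _ S m f fC n (codom w) nm' s').
have cDPhi W : nbhs (DPhi (e 0) (u 0) e') W -> exists Q N V,
    [/\ nbhs (e 0) Q, nbhs (u 0) N, nbhs e' V &
      forall s w d, S s -> Q s -> N w -> V d -> W (DPhi s w d)].
  have dE : DPhi (e 0) (u 0) e' = jet f n.+1 s0 (rcons (codom (u 0)) e').
    exact: (ajetE f n.+1 s0 _).
  rewrite dE => nW.
  have H : (fun p : S * P * E => jet f n.+1 p.1.1 (rcons (codom p.1.2) p.2)) @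
      (nbhs ((s0, u 0), e')) --> jet f n.+1 s0 (rcons (codom (u 0)) e').
    have c1 : (fun p : S * P * E => p.1) @ nbhs ((s0, u 0), e') --> (s0, u 0).
      exact: cvg_fst.
    have c12 : (fun p : S * P * E => p.1.2) @ nbhs ((s0, u 0), e') --> u 0.
      by apply: (cvg_comp _ _ c1); exact: cvg_snd.
    apply: (jet_cvg _ fC) => //.
      by apply: (cvg_comp _ _ c1); exact: cvg_fst.
    move=> i; rewrite ltnS leq_eqVlt => /predU1P[->|ltin].
      under eq_fun do rewrite nth_rcons size_codom card_ord ltnn eqxx.
      rewrite nth_rcons size_codom card_ord ltnn eqxx; exact: cvg_snd.
    have nthE (w : P) d : nth 0 (rcons (codom w) d) i = w (Ordinal ltin).
      rewrite nth_rcons size_codom card_ord ltin codomE (nth_map (Ordinal ltin)).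
        by congr (w _); apply: val_inj; rewrite /= nth_enum_ord.
      by rewrite size_enum_ord.
    rewrite nthE; under eq_fun do rewrite nthE.
    exact: (cvg_comp _ _ c12 (@proj_continuous _ _ (Ordinal ltin) (u 0))).
  have [[A V] /= [[[A1 N] /= [nA1 nN] A1N] nV] AV] := H _ nW.
  have [_ [[Q oQ <-] Qe QA]] := nA1.
  exists Q, N, V; split=> //; first by apply: open_nbhs_nbhs.
  move=> s w d Ss Qs Nw Vd; pose s' : S := SigSub (mem_set Ss).
  rewrite /DPhi -[s]/(val s') ajetE.
  apply: (AV (s', w, d)); split=> //=; apply: (A1N (s', w)); split=> //=.
  exact: QA.
have H1 : (fun h => h^-1 *: (ajet f n (e h) (vs h) - ajet f n (e 0) (vs h))) @ 0^' -->
    ajet f n.+1 (e 0) (rcons (vs 0) e').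
  have <- : DPhi (e 0) (u 0) e' = ajet f n.+1 (e 0) (rcons (vs 0) e').
    by rewrite /DPhi codomu.
  move=> W nW.
  have [Q [N [V [nQ nN nV W_q]]]] := difference_quotient_near lcS regS Se0 dPhi cPhi cDPhi nW.
  have ce := curve_deriv0_cvg de.
  have nS : \forall h \near (0 : K)^', S (e h) by exact: nbhs_dnbhs.
  have nQ' : \forall h \near (0 : K)^', Q (e h) by exact: ce.
  have nN' : \forall h \near (0 : K)^', N (u h) by exact: cu.
  have nV' : \forall h \near (0 : K)^', V (h^-1 *: (e h - e 0)) by exact: de.
  have n0 := @nbhs_dnbhs_neq _ (0 : K).
  change (\forall h \near (0 : K)^', W (h^-1 *: (ajet f n (e h) (vs h) - ajet f n (e 0) (vs h)))).
  near=> h.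
  have hn0 : h != 0 by near: h.
  have eh : e h = e 0 + h *: (h^-1 *: (e h - e 0)).
    by rewrite scalerA mulfV// scale1r addrC subrK.
  have := W_q (e 0) (u h) (h^-1 *: (e h - e 0)) h hn0 Se0 (nbhs_singleton nQ).
  rewrite -eh /Phi !codomu; apply.
  - by near: h.
  - by near: h.
  - by near: h.
  - by near: h.
apply: (cvg_trans _ (cvg_add _ H1 H2)); apply: near_eq_cvg; apply: nearW => h.
by rewrite -scalerDr addrA subrK.
Unshelve. all: by end_near. Qed.

End chain_rule.

(** * Faa di Bruno formula *)

Section terms.

(* Indices refer to two sequences of directions, [qz] in Z and [qx] in X. A
   block [(C, B)] stands for the derivative of [eta] along [qz] over [C], then
   along [qx] over [B]; a term [(C, bs)] for the derivative of [gamma] along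
   [qz] over [C], then along the vectors given by the blocks [bs]. The letters
   [inl i], [inr i] stand for the directions [qz i], [qx i]. *)
Definition block : Type := (seq nat * seq nat)%type.
Definition term : Type := (seq nat * seq block)%type.
Definition letter : Type := (nat + nat)%type.

Definition add_letter (c : letter) (b : block) : block :=
  match c with inl i => (rcons b.1 i, b.2) | inr i => (b.1, rcons b.2 i) end.

Fixpoint insertions (g : block -> block) (pre bs : seq block) : seq (seq block) :=
  if bs is b :: bs' then (pre ++ g b :: bs') :: insertions g (rcons pre b) bs'
  else [::].

(* The terms obtained by differentiating a term: the letter hits [gamma], the
   base point (a new block appears) or one of the existing blocks. *)
Definition step (c : letter) (t : term) : seq term :=
  (if c is inl i then [:: (rcons t.1 i, t.2)] else [::]) ++
  (t.1, rcons t.2 (add_letter c ([::], [::]))) ::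
  [seq (t.1, bs) | bs <- insertions (add_letter c) [::] t.2].

Definition terms (w : seq letter) : seq term :=
  foldl (fun ts c => flatten [seq step c t | t <- ts]) [:: ([::], [::])] w.

Lemma terms_rcons w c : terms (rcons w c) = flatten [seq step c t | t <- terms w].
Proof. by rewrite /terms foldl_rcons. Qed.

Definition is_inl (c : letter) : bool := if c is inl _ then true else false.
Definition zdeg (w : seq letter) := count is_inl w.
Definition xdeg (w : seq letter) := count (predC is_inl) w.

(** The orders of a term coming from [a] letters of Z and [b] letters of X. The bound [a + b] on the
    number of blocks is the origin of the smoothness l + k required of the maps [gamma z]; the other
    bounds are met by [gamma] being C^k and by [eta] being C^k into C^l. *)
Definition term_bound (a b : nat) (t : term) : bool :=
  [&& (size t.1 <= a)%N, (size t.2 <= a + b)%N &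
   all (fun c => (size c.1 <= a)%N && (size c.2 <= b)%N) t.2].

Lemma insertions_all (g : block -> block) (Q0 Q1 : pred block) pre bs cs :
  (forall b, Q0 b -> Q1 b && Q1 (g b)) -> all Q1 pre -> all Q0 bs ->
  cs \in insertions g pre bs ->
  all Q1 cs.
Proof.
move=> Qg; elim: bs pre => //= b bs IH pre Qpre /andP[/Qg/andP[Qb Qgb] Qbs].
rewrite in_cons => /predU1P[->|cs_in].
  rewrite all_cat Qpre /= Qgb /=.
  by apply/allP => c /(allP Qbs)/Qg/andP[].
have := IH (rcons pre b) _ Qbs cs_in.
by rewrite all_rcons Qb Qpre => /(_ isT).
Qed.

Lemma insertions_size (g : block -> block) pre bs cs :
  cs \in insertions g pre bs -> size cs = (size pre + size bs)%N.
Proof.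
elim: bs pre => //= b bs IH pre; rewrite in_cons => /predU1P[->|/IH ->].
  by rewrite size_cat.
by rewrite size_rcons addSnnS.
Qed.

Lemma term_bound_step a b c t t' : term_bound a b t -> t' \in step c t ->
  term_bound (a + is_inl c) (b + ~~ is_inl c) t'.
Proof.
case/and3P => sa sb /allP bs; rewrite /step mem_cat in_cons.
have le_a : (a <= a + is_inl c)%N by exact: leq_addr.
have le_b : (b <= b + ~~ is_inl c)%N by exact: leq_addr.
have mono : all (fun d : block => (size d.1 <= a + is_inl c) && (size d.2 <= b + ~~ is_inl c))%N t.2.
  by apply/allP => d /bs /andP[d1 d2]; rewrite (leq_trans d1)// (leq_trans d2).
have sab : (a + is_inl c + (b + ~~ is_inl c) = (a + b).+1)%N.
  by case: (is_inl c) => /=; lia.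
case/or3P.
- case: c le_a le_b mono sab => // i le_a le_b mono sab /[!inE] /eqP ->.
  by rewrite /term_bound /= size_rcons mono addn1 ltnS sa /= addn0; lia.
- move=> /eqP ->; rewrite /term_bound /= size_rcons sab ltnS sb all_rcons mono.
  by rewrite (leq_trans sa le_a) !andbT /=; case: (c) => i /=; rewrite ?addn1 ?addn0.
- move=> /mapP[cs cs_in ->]; rewrite /term_bound /= (leq_trans sa le_a) sab.
  rewrite (insertions_size cs_in) add0n (leq_trans sb)//=.
  suff -> : all (fun d : block =>
      (size d.1 <= a + is_inl c) && (size d.2 <= b + ~~ is_inl c))%N cs by [].
  apply: (@insertions_all _ (fun d : block => (size d.1 <= a) && (size d.2 <= b))%N _ _ t.2 _ _ _ _ cs_in) => //; last exact/allP.
  move=> d /andP[d1 d2]; apply/andP; split.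
    by rewrite (leq_trans d1)// (leq_trans d2).
  by case: (c) => i /=; rewrite size_rcons ?addn1 ?addn0 ?ltnS d1 d2.
Qed.

Lemma terms_bound w t : t \in terms w -> term_bound (zdeg w) (xdeg w) t.
Proof.
elim/last_ind: w t => [t|w c IH t].
  by rewrite inE => /eqP ->.
rewrite terms_rcons => /flatten_mapP[t' /IH t'b /(term_bound_step t'b)].
by rewrite /zdeg /xdeg -!cats1 !count_cat /= !addn0.
Qed.

Lemma zdeg_cat w w' : zdeg (w ++ w') = (zdeg w + zdeg w')%N.
Proof. exact: count_cat. Qed.

Lemma xdeg_cat w w' : xdeg (w ++ w') = (xdeg w + xdeg w')%N.
Proof. exact: count_cat. Qed.

Lemma zdeg_rcons w c : zdeg (rcons w c) = (zdeg w + is_inl c)%N.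
Proof. by rewrite -cats1 zdeg_cat /zdeg /= addn0. Qed.

Lemma xdeg_rcons w c : xdeg (rcons w c) = (xdeg w + ~~ is_inl c)%N.
Proof. by rewrite -cats1 xdeg_cat /xdeg /= addn0. Qed.

Lemma zdeg_inl (s : seq nat) : zdeg (map inl s) = size s.
Proof. by elim: s => //= i s; rewrite /zdeg /= => ->. Qed.

Lemma xdeg_inl (s : seq nat) : xdeg (map inl s) = 0%N.
Proof. by elim: s. Qed.

Lemma zdeg_inr (s : seq nat) : zdeg (map inr s) = 0%N.
Proof. by elim: s. Qed.

Lemma xdeg_inr (s : seq nat) : xdeg (map inr s) = size s.
Proof. by elim: s => //= i s; rewrite /xdeg /= => ->. Qed.

End terms.

(** * Auxiliary results on jets, curves and words *)

Lemma set_type_continuous (P T : topologicalType) (S : set T) (f : P -> S) :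
  continuous (fun p => val (f p)) -> continuous f.
Proof.
move=> cf p U [_ [[W oW <-] Wp WU]].
have nW : nbhs p ((fun p => val (f p)) @^-1` W).
  by apply: cf; exact: open_nbhs_nbhs.
by apply: filterS nW => x; exact: WU.
Qed.

(** There are two sources of continuity: evaluation along a compact space, or a fixed element of
    C^l(R, Y), whose jets are continuous on any space. The second case makes the maps for fixed [z]
    elements of C^l(R, F). *)
Lemma Cspace_jet_continuous (K : realType) (X Y : lcsType K) (R : set X)
    (l : smoothness) (P : topologicalType) (q : P -> Cspace l R Y) (n : nat)
    (r : P -> R) (u : P -> seq X) :
  (compact [set: P] /\ continuous q) \/ (forall p p', q p = q p') ->
  le_smooth n l -> continuous r ->
  (forall i, (i < n)%N -> continuous (fun p => nth 0 (u p) i)) ->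
  continuous (fun p => jet (q p) n (r p) (u p)).
Proof.
move=> [[cP cq]|qE] nl cr cu p.
  exact: (@Cspace_jet_evaluation K X Y R l P (nbhs p) q (q p) n r u p cP _
    (fun U H => H) nl (cq p) cr cu).
rewrite /continuous_at; under eq_fun do rewrite (qE _ p).
apply: (jet_cvg _ (CspaceP (q p))) => //; first exact: cr.
by move=> i ltin; exact: cu.
Qed.

Lemma has_dderiv_curve0 (K : realType) (X Y : lcsType K) (f : X -> Y) (x v : X) (d : Y) :
  has_dderiv f x v d <-> curve_deriv0 (fun h : K => f (x + h *: v)) d.
Proof. by rewrite /has_dderiv /curve_deriv0 scale0r addr0. Qed.

Lemma curve_deriv0_eq_near (K : realType) (Y : lcsType K) (phi psi : K -> Y) (d : Y) :
  (\forall h \near (0 : K), phi h = psi h) -> curve_deriv0 phi d -> curve_deriv0 psi d.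
Proof.
move=> phipsi dphi; apply: (cvg_trans _ dphi); apply: near_eq_cvg.
have E0 : phi 0 = psi 0 := nbhs_singleton phipsi.
by apply: nbhs_dnbhs; apply: filterS phipsi => h ->; rewrite E0.
Qed.

Lemma slot_sum_insertions (K : realType) (E F : lcsType K) (M : seq E -> F)
    (v : block -> K -> E) (v' u : block -> E) (g : block -> block) pre bs :
  (forall b, v b 0 = u b) -> (forall b, v' b = u (g b)) ->
  slot_sum M v v' (map u pre) bs = \sum_(cs <- insertions g pre bs) M (map u cs).
Proof.
move=> vE v'E; elim: bs pre => [|b bs IH] pre /=; first by rewrite big_nil.
rewrite big_cons vE -map_rcons IH map_cat /= v'E; congr (M (_ ++ _ :: _) + _).
by apply: eq_map.
Qed.

Lemma has_dderiv_valL_sum (K : realType) (X Y : lcsType K) (R : set X) (T : eqType)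
    (ts : seq T) (f : T -> R -> Y) (d : T -> Y) (x : R) (v : X) : R° (val x) ->
  {in ts, forall t, has_dderiv ('valL_ 0 (f t)) (val x) v (d t)} ->
  has_dderiv ('valL_ 0 (fun x => \sum_(t <- ts) f t x)) (val x) v (\sum_(t <- ts) d t).
Proof.
move=> Rx; have oR := @open_interior _ R.
elim: ts => [_|t ts IH df].
  rewrite big_nil; apply: (has_dderiv_eq_open oR Rx _ (has_dderiv0 (val x) v)) => z Rz.
  by rewrite (valL_at _ (interior_subset Rz)) big_nil.
rewrite big_cons -[d t]scale1r; apply: (has_dderiv_lin (f := 'valL_ 0 (f t))
  (g := 'valL_ 0 (fun x => \sum_(t <- ts) f t x)) oR Rx).
- move=> z Rz; have E (g : R -> Y) := valL_at g (interior_subset Rz).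
  by rewrite !E big_cons scale1r.
- by apply: df; rewrite mem_head.
- by apply: IH => t' t'ts; apply: df; rewrite in_cons t'ts orbT.
Qed.

(** Compact intervals of scalars provide the test spaces through which k-continuity is used near a
    point of a line. *)
Lemma compact_nbhs0 (K : realType) (P : set K) :
  (\forall h \near (0 : K), P h) -> exists N : set K,
    [/\ compact N, nbhs (0 : K) N & N `<=` P].
Proof.
move=> /near_abs_lt[r r0 rP]; exists `[- (r / 2), r / 2]%classic; split.
- exact: segment_compact.
- apply/near_abs_lt; exists (r / 2); first by rewrite divr_gt0.
  by move=> h; rewrite /= in_itv /= -ler_norml => /ltW.
- move=> h; rewrite /= in_itv /= -ler_norml => hr; apply: rP.
  by rewrite (le_lt_trans hr)// ltr_pdivrMr// mulr_natr mulr2n ltrDl.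
Qed.

Lemma line_continuous (K : realType) (T : topologicalType) (V : lcsType K)
    (s : T -> K) (x v : V) : continuous s -> continuous (fun p => x + s p *: v).
Proof.
move=> cs p; exact: (cvg_add _ (@cst_continuous _ _ x p)
  (cvg_scalel _ (cs p) (@cst_continuous _ _ v p))).
Qed.

Lemma dderiv_unique (K : realType) (X : lcsType K) (Y : preTopologicalLmodType K)
    (f : X -> Y) (x v : X) (d : Y) :
  hausdorff_space Y -> has_dderiv f x v d -> dderiv v f x = d.
Proof.
by move=> hY fd; apply: xget_unique => // d' fd'; exact: (cvg_unique hY fd' fd).
Qed.

Lemma nth_codom_continuous (K : realType) (X : lcsType K) (i n : nat) :
  continuous (fun y : {ptws 'I_i -> X} => nth 0 (codom y) n).
Proof.
have [ltni|leni] := ltnP n i; last first.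
  have -> : (fun y : {ptws 'I_i -> X} => nth 0 (codom y) n) = (fun=> 0).
    by apply/funext => y; rewrite nth_default// size_codom card_ord.
  exact: cst_continuous.
have -> : (fun y : {ptws 'I_i -> X} => nth 0 (codom y) n) = (fun y => y (Ordinal ltni)).
  apply/funext => y; rewrite codomE (nth_map (Ordinal ltni)).
    by congr (y _); apply: val_inj; rewrite /= nth_enum_ord.
  by rewrite size_enum_ord.
by move=> y; exact: (@proj_continuous _ _ (Ordinal ltni) y).
Qed.

Lemma map_nth_codom (T : Type) (x0 : T) (i : nat) (y : 'I_i -> T) :
  map (nth x0 (codom y)) (iota 0 i) = codom y.
Proof. by rewrite -[in iota 0 i](card_ord i) -(size_codom y); exact: mkseq_nth. Qed.

Definition zword (j : nat) : seq letter := map inl (iota 0 j).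
Definition xword (i : nat) : seq letter := map inr (iota 0 i).

Lemma iotaS_rcons (j : nat) : iota 0 j.+1 = rcons (iota 0 j) j.
Proof. by rewrite -addn1 iotaD cats1. Qed.

Lemma zwordS j : zword j.+1 = rcons (zword j) (inl j).
Proof. by rewrite /zword iotaS_rcons map_rcons. Qed.

Lemma xwordS i : xword i.+1 = rcons (xword i) (inr i).
Proof. by rewrite /xword iotaS_rcons map_rcons. Qed.

Lemma zdeg_zword j : zdeg (zword j) = j.
Proof. by rewrite zdeg_inl size_iota. Qed.

Lemma xdeg_zword j : xdeg (zword j) = 0%N.
Proof. exact: xdeg_inl. Qed.

Lemma zdeg_xword i : zdeg (xword i) = 0%N.
Proof. exact: zdeg_inr. Qed.

Lemma xdeg_xword i : xdeg (xword i) = i.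
Proof. by rewrite xdeg_inr size_iota. Qed.

(** * The composite map and its mixed partial derivatives *)

Section composition.
Context {K : realType} {E F X Z : lcsType K}.
Variables (A : set Z) (R : set X) (S : set E) (k l : smoothness).
Hypotheses (regA : regular_subset A) (regR : regular_subset R)
  (regS : regular_subset S) (lcS : locally_convex_subset S).
Variables (gamma : A -> Cspace (add_smooth l k) S F) (eta : A -> Cspace l R E).
Hypotheses (gammaC : isC k gamma) (etaC : isC k eta)
  (etaS : forall (z : A) (x : R), S (eta z x)).

Implicit Types (qz : nat -> Z) (qx : nat -> X) (b : block) (t : term).

Definition gamma_jet qz (C : seq nat) (z : A) : Cspace (add_smooth l k) S F :=
  jet gamma (size C) z (map qz C).

Definition eta_jet qz (C : seq nat) (z : A) : Cspace l R E :=
  jet eta (size C) z (map qz C).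

Definition block_val qz qx (z : A) (x : R) b : E :=
  jet (eta_jet qz b.1 z) (size b.2) x (map qx b.2).

Definition base_pt (z : A) (x : R) : S := SigSub (mem_set (etaS z x)).

Definition term_val qz qx (z : A) (x : R) t : F :=
  jet (gamma_jet qz t.1 z) (size t.2) (base_pt z x)
    [seq block_val qz qx z x b | b <- t.2].

(* The mixed partial derivative of [(z, x) |-> gamma z (eta z x)] along the
   directions named by the word [w], as given by the Faa di Bruno formula. It is
   also defined at boundary points, by the continuous extensions of the jets. *)
Definition word_val qz qx (w : seq letter) (z : A) (x : R) : F :=
  \sum_(t <- terms w) term_val qz qx z x t.

Lemma block_val0 qz qx z x : block_val qz qx z x ([::], [::]) = eta z x.
Proof.
rewrite /block_val /eta_jet /= jet0//; last 2 first.
- exact: lcs_hausdorff.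
- exact: (CspaceP _).1.
by rewrite jet0//; [exact: Cspace_hausdorff|exact: etaC.1].
Qed.

Lemma word_val0 qz qx z x : word_val qz qx [::] z x = gamma z (base_pt z x).
Proof.
rewrite /word_val big_seq1 /term_val /gamma_jet /= jet0//; last 2 first.
- exact: lcs_hausdorff.
- exact: (CspaceP _).1.
by rewrite jet0//; [exact: Cspace_hausdorff|exact: gammaC.1].
Qed.

Section continuity.
Variables (P : topologicalType) (pz : P -> nat -> Z) (px : P -> nat -> X)
  (z : P -> A) (x : P -> R).
Hypotheses (cpz : forall i, continuous (fun p => pz p i))
  (cpx : forall i, continuous (fun p => px p i))
  (cz : continuous z) (cx : continuous x).
Hypothesis compact_or_const : compact [set: P] \/
  (forall p p', z p = z p' /\ pz p = pz p').

Lemma block_val_continuous b : le_smooth (size b.1) k -> le_smooth (size b.2) l ->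
  continuous (fun p => block_val (pz p) (px p) (z p) (x p) b).
Proof.
move=> b1k b2l; apply: Cspace_jet_continuous => //.
  case: compact_or_const => [cP|PE]; [left; split=> // p|right].
    apply: (jet_cvg _ etaC) => //; first exact: cz.
    move=> i lti; rewrite (nth_map 0%N)//; under eq_fun do rewrite (nth_map 0%N)//.
    exact: cpz.
  by move=> p p'; rewrite /eta_jet; have [-> ->] := PE p p'.
move=> i lti p; rewrite /continuous_at (nth_map 0%N)//.
under eq_fun do rewrite (nth_map 0%N)//.
exact: cpx.
Qed.

Lemma term_val_continuous (a c : nat) t : le_smooth a k -> le_smooth c l ->
  term_bound a c t ->
  continuous (fun p => term_val (pz p) (px p) (z p) (x p) t).
Proof.
move=> ak cl /and3P[t1 t2 /allP tb].
apply: Cspace_jet_continuous => //.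
- case: compact_or_const => [cP|PE]; [left; split=> // p|right].
    apply: (jet_cvg _ gammaC) => //; first exact: le_smoothW ak.
      exact: cz.
    move=> i lti; rewrite (nth_map 0%N)//; under eq_fun do rewrite (nth_map 0%N)//.
    exact: cpz.
  by move=> p p'; rewrite /gamma_jet; have [-> ->] := PE p p'.
- move: ak cl t2; case: (k) => [?|]; case: (l) => //= [?] ak cl t2.
  by rewrite (leq_trans t2)// addnC leq_add.
- apply: set_type_continuous => p /=.
  rewrite /continuous_at -[eta _ _](block_val0 (pz p) (px p)).
  have -> : (fun p => eta (z p) (x p)) =
      (fun p => block_val (pz p) (px p) (z p) (x p) ([::], [::])).
    by apply/funext => p'; rewrite block_val0.
  by apply: block_val_continuous; [case: (k)|case: (l)].
- move=> i lti p; rewrite /continuous_at (nth_map ([::], [::]))//.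
  under eq_fun do rewrite (nth_map ([::], [::]))//.
  have /andP[b1 b2] := tb _ (mem_nth ([::], [::]) lti).
  by apply: block_val_continuous; [exact: le_smoothW ak|exact: le_smoothW cl].
Qed.

Lemma word_val_continuous w : le_smooth (zdeg w) k -> le_smooth (xdeg w) l ->
  continuous (fun p => word_val (pz p) (px p) w (z p) (x p)).
Proof.
move=> wk wl p; rewrite /word_val.
have := @terms_bound w; elim: (terms w) => [_|t ts IH tb].
  by rewrite /continuous_at; under eq_fun do rewrite big_nil; rewrite big_nil; exact: cvg_cst.
rewrite /continuous_at big_cons; under eq_fun do rewrite big_cons.
apply: cvg_add.
  by apply: (term_val_continuous wk wl); apply: tb; rewrite mem_head.
by apply: IH => t' t'ts; apply: tb; rewrite in_cons t'ts orbT.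
Qed.

End continuity.

Lemma near_shift (V : lcsType K) (U : set V) (x v : V) : open U -> U x ->
  \forall h \near (0 : K), U (x + h *: v).
Proof.
move=> oU Ux; have : (fun h : K => x + h *: v) @ (0 : K) --> x + (0 : K) *: v.
  by apply: cvg_add; [exact: cvg_cst|apply: cvg_scalel; [exact: cvg_id|exact: cvg_cst]].
by rewrite scale0r addr0 => /(_ U); apply; exact: open_nbhs_nbhs.
Qed.

Lemma block_val_xderiv qz qx z (x : R) b i : le_smooth (size b.2).+1 l -> R° (val x) ->
  has_dderiv ('valL_ 0 (fun x => block_val qz qx z x b)) (val x) (qx i)
    (block_val qz qx z x (add_letter (inr i) b)).
Proof.
move=> bl Rx; rewrite /block_val /= size_rcons map_rcons.
exact: (@has_dderiv_jet K X E R l (eta_jet qz b.1 z) (size b.2) x (map qx b.2)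
  (qx i) (CspaceP _) bl (size_map _ _) Rx).
Qed.

Lemma term_val_xderiv qz qx z (x : R) t i (a c : nat) :
  le_smooth a k -> le_smooth c.+1 l -> term_bound a c t -> R° (val x) ->
  has_dderiv ('valL_ 0 (fun x => term_val qz qx z x t)) (val x) (qx i)
    (\sum_(t' <- step (inr i) t) term_val qz qx z x t').
Proof.
move=> ak cl /and3P[t1 t2 /allP tb] Rx; set n := size t.2.
have nlk : le_smooth n.+1 (add_smooth l k).
  move: ak cl t2; rewrite -/n; case: (k) => [?|]; case: (l) => //= ? ak cl t2.
  by rewrite (leq_ltn_trans t2)// addnC -addSn leq_add.
pose y := qx i; pose f := gamma_jet qz t.1 z.
(* The base point is the value of the empty block, so its derivative is the block consisting of the
   new letter alone; this is the block appended in [step]. *)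
pose e (h : K) := 'valL_ 0 (fun x => block_val qz qx z x ([::], [::])) (val x + h *: y).
pose v b (h : K) := 'valL_ 0 (fun x => block_val qz qx z x b) (val x + h *: y).
pose u b := block_val qz qx z x b.
have v0 b : v b 0 = u b by rewrite /v scale0r addr0; exact: valLE.
have e0 : e 0 = val (base_pt z x) by rewrite -[RHS](block_val0 qz qx); exact: v0.
have nR : \forall h \near (0 : K), R° (val x + h *: y).
  by apply: near_shift => //; exact: open_interior.
have eE h (Rh : R° (val x + h *: y)) : e h = val (base_pt z (SigSub (mem_set (interior_subset Rh)))).
  rewrite /e (valL_at _ (interior_subset Rh)); exact: block_val0.
have := @jet_chain_rule K E F S _ lcS regS f (CspaceP f) block v
  (fun b => u (add_letter (inr i) b)) n e (u (add_letter (inr i) ([::], [::]))) t.2 nlk erefl.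
rewrite e0 ajetE; set d := _ + slot_sum _ _ _ _ _ => H.
have dE : d = \sum_(t' <- step (inr i) t) term_val qz qx z x t'.
  rewrite /d /step /= big_cons big_map; congr (_ + _).
    rewrite /term_val /= size_rcons map_rcons; congr (jet _ _ _ (rcons _ _)).
    exact: eq_map.
  rewrite (@slot_sum_insertions _ _ _ _ v _ u (add_letter (inr i)) [::] t.2 v0 (fun _ => erefl)).
  apply: eq_big_seq => cs /insertions_size szcs.
  by rewrite (ajetE f n (base_pt z x)) /term_val /= szcs.
rewrite -dE; apply/has_dderiv_curve0.
apply: (@curve_deriv0_eq_near _ _ (fun h => ajet f n (e h) [seq v b h | b <- t.2])).
  apply: filterS nR => h Rh; rewrite (eE h Rh) ajetE (valL_at _ (interior_subset Rh)).
  rewrite /term_val; congr (jet _ _ _ _); apply: eq_map => b.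
  by rewrite /v (valL_at _ (interior_subset Rh)).
apply: H.
- exact: etaS.
- by apply: filterS nR => h Rh; rewrite (eE h Rh); exact: etaS.
- by apply/has_dderiv_curve0; apply: block_val_xderiv => //; exact: le_smoothW cl.
- move=> b /tb /andP[b1 b2]; apply/has_dderiv_curve0; apply: block_val_xderiv => //.
  exact: le_smoothW cl.
Qed.

Lemma block_val_zderiv qz qx (z : A) x b i :
  le_smooth (size b.1).+1 k -> le_smooth (size b.2) l -> A° (val z) ->
  has_dderiv ('valL_ 0 (fun z => block_val qz qx z x b)) (val z) (qz i)
    (block_val qz qx z x (add_letter (inl i) b)).
Proof.
move=> bk bl Az.
have := @has_dderiv_jet K Z _ A k eta (size b.1) z (map qz b.1) (qz i) etaC bk
  (size_map _ _) Az.
rewrite /has_dderiv => /(Cspace_jet_cvg (x := x) (ys := map qx b.2) _ bl) H.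
have -> : block_val qz qx z x (add_letter (inl i) b) =
    jet (jet eta (size b.1).+1 z (rcons (map qz b.1) (qz i))) (size b.2) x (map qx b.2).
  by rewrite /block_val /= /eta_jet size_rcons map_rcons.
apply: (cvg_trans _ H); apply: near_eq_cvg.
apply: nbhs_dnbhs.
have nA : \forall h \near (0 : K), A° (val z + h *: qz i).
  by apply: near_shift => //; exact: open_interior.
apply: filterS nA => h Ah.
have Cl (f : Cspace l R E) := CspaceP f.
have zE : 'valL_ 0 (fun z => jet eta (size b.1) z (map qz b.1)) (val z) =
  jet eta (size b.1) z (map qz b.1) by exact: valLE.
have zhE : 'valL_ 0 (fun z => jet eta (size b.1) z (map qz b.1)) (val z + h *: qz i) =
  jet eta (size b.1) (SigSub (mem_set (interior_subset Ah))) (map qz b.1) by exact: valL_at.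
rewrite zE zhE (valL_at _ (interior_subset Ah)) valLE.
by rewrite Cspace_scale (jet_scale regR _ _ _ (Cl _) bl) Cspace_sub (jet_sub regR _ _ (Cl _) (Cl _) bl).
Qed.

Lemma gamma_jet_zderiv qz (z : A) C i : le_smooth (size C).+1 k -> A° (val z) ->
  (fun h : K => h^-1 *: ('valL_ 0 (gamma_jet qz C) (val z + h *: qz i) -
     gamma_jet qz C z)) @ 0^' --> gamma_jet qz (rcons C i) z.
Proof.
move=> Ck Az; rewrite /gamma_jet size_rcons map_rcons.
have := @has_dderiv_jet K Z _ A k gamma (size C) z (map qz C) (qz i) gammaC Ck
  (size_map _ _) Az.
by rewrite /has_dderiv (valLE (fun z => jet gamma (size C) z (map qz C)) z).
Qed.

(** The increment splits into the one of [gamma_jet] in C^(l+k)(S, F), evaluated at the moving base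
    point and blocks, and the one of the base point and blocks for the fixed map [f]. The second is
    the chain rule; the first is an evaluation at moving points, hence made along a compact
    interval. *)
Lemma term_val_zderiv qz qx (z : A) x t i (a c : nat) :
  le_smooth a.+1 k -> le_smooth c l -> term_bound a c t -> A° (val z) ->
  has_dderiv ('valL_ 0 (fun z => term_val qz qx z x t)) (val z) (qz i)
    (\sum_(t' <- step (inl i) t) term_val qz qx z x t').
Proof.
move=> ak cl tac Az; have := tac => /and3P[t1 t2 /allP tb]; set n := size t.2.
have ak' : le_smooth a k by exact: le_smoothW ak.
have nlk : le_smooth n.+1 (add_smooth l k).
  move: ak cl t2; rewrite -/n; case: (k) => [?|]; case: (l) => //= ? ak cl t2.
  by rewrite (leq_ltn_trans t2)// addnC -addnS leq_add.
have nlk' : le_smooth n (add_smooth l k) by exact: le_smoothW nlk.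
pose w := qz i; pose f := gamma_jet qz t.1 z.
pose e (h : K) := 'valL_ 0 (fun z => block_val qz qx z x ([::], [::])) (val z + h *: w).
pose v b (h : K) := 'valL_ 0 (fun z => block_val qz qx z x b) (val z + h *: w).
pose u b := block_val qz qx z x b.
pose vs h := [seq v b h | b <- t.2].
have v0 b : v b 0 = u b by rewrite /v scale0r addr0; exact: valLE.
have e0 : e 0 = val (base_pt z x) by rewrite -[RHS](block_val0 qz qx); exact: v0.
have nA : \forall h \near (0 : K), A° (val z + h *: w).
  by apply: near_shift => //; exact: open_interior.
pose zh h (Ah : A° (val z + h *: w)) : A := SigSub (mem_set (interior_subset Ah)).
have eE h (Ah : A° (val z + h *: w)) : e h = val (base_pt (zh h Ah) x).
  rewrite /e (valL_at _ (interior_subset Ah)); exact: block_val0.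
have vE h (Ah : A° (val z + h *: w)) b : v b h = block_val qz qx (zh h Ah) x b.
  by rewrite /v (valL_at _ (interior_subset Ah)).
have := @jet_chain_rule K E F S _ lcS regS f (CspaceP f) block v
  (fun b => u (add_letter (inl i) b)) n e (u (add_letter (inl i) ([::], [::]))) t.2 nlk erefl.
rewrite e0 ajetE; set d := _ + slot_sum _ _ _ _ _ => H.
have {}H : curve_deriv0 (fun h => ajet f n (e h) (vs h)) d.
  apply: H.
  - exact: etaS.
  - by apply: filterS nA => h Ah; rewrite (eE h Ah); exact: etaS.
  - apply/has_dderiv_curve0; apply: block_val_zderiv => //=; first exact: le_smoothW ak.
    exact: le_smoothW cl.
  - move=> b /tb /andP[b1 b2]; apply/has_dderiv_curve0; apply: block_val_zderiv => //.
      exact: le_smoothW ak.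
    exact: le_smoothW cl.
pose g h : Cspace (add_smooth l k) S F :=
  h^-1 *: ('valL_ 0 (gamma_jet qz t.1) (val z + h *: w) - f).
have H1 : (fun h => ajet (g h) n (e h) (vs h)) @ 0^' -->
    term_val qz qx z x (rcons t.1 i, t.2).
  have /near_abs_lt[r r0 rA] := nA.
  pose N := `[- (r / 2), r / 2]%classic : set K.
  have cN : compact [set: N] by apply: compact_set_type; exact: segment_compact.
  have NA (p : N) : A° (val z + val p *: w).
    apply: rA; have : N (val p) by exact: set_mem (valP p).
    rewrite /N /= in_itv /= -ler_norml => /le_lt_trans; apply.
    by rewrite ltr_pdivrMr// mulr_natr mulr2n ltrDl.
  pose zN (p : N) : A := zh (val p) (NA p).
  have czN : continuous zN.
    apply: set_type_continuous => p.
    have H1 : (fun p : N => val p : K) @ p --> (val p : K) by exact: initial_continuous.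
    have H2 : (fun p : N => val p *: w) @ p --> val p *: w.
      exact: (cvg_scalel _ H1 (@cst_continuous _ _ w p)).
    have H3 : (fun p : N => val z) @ p --> val z := @cst_continuous _ _ (val z) p.
    exact: (cvg_add _ H3 H2).
  have N0 : N 0 by rewrite /N /= in_itv/= oppr_le0 divr_ge0 ?(ltW r0).
  pose p0 : N := SigSub (mem_set N0).
  have z0 : zN p0 = z by apply: val_inj; rewrite /= scale0r addr0.
  (* The trace on the compact interval [N] of the punctured neighbourhoods of 0. The point 0 must be
     avoided, since there the quotient [g] has the default value 0 instead of the derivative. *)
  pose G : set_system N := [set U | \forall h \near (0 : K)^', forall p : N, val p = h -> U p].
  have FG : Filter G.
    split.
    - exact: (@filterE K (0 : K)^' _ (fun h => forall p : N, val p = h -> setT p)).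
    - move=> U V GU GV; change (\forall h \near (0 : K)^', forall p : N, val p = h -> (U `&` V) p).
      by apply: (@filterS2 K (0 : K)^' _ _ _ _ _ GU GV) => h Uh Vh p ph; split; [exact: Uh|exact: Vh].
    - move=> U V UV GU; change (\forall h \near (0 : K)^', forall p : N, val p = h -> V p).
      by apply: (@filterS K (0 : K)^' _ _ _ _ GU) => h Uh p ph; apply: UV; exact: Uh.
  have Gp0 : G --> p0.
    move=> U [_ [[W oW <-] W0 WU]].
    have nW : \forall h \near (0 : K)^', W h by apply: nbhs_dnbhs; exact: open_nbhs_nbhs.
    by apply: filterS nW => h Wh p ph; apply: WU; rewrite /= -ph in Wh *.
  have qG : (fun p : N => g (val p)) @ G --> gamma_jet qz (rcons t.1 i) z.
    move=> U nU.
    have := @gamma_jet_zderiv qz z t.1 i (@le_smoothW (size t.1).+1 a.+1 k t1 ak) Az U nU.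
    rewrite /fmap/= => gU; change (\forall h \near (0 : K)^', U (g h)) in gU.
    by apply: filterS gU => h gU p ph; rewrite /= ph.
  have cond : compact [set: N] \/ (forall p p', zN p = zN p' /\ qz = qz) by left.
  have cst (T : topologicalType) (y : T) : continuous (fun _ : N => y) by exact: cst_continuous.
  have cblk b : le_smooth (size b.1) k -> le_smooth (size b.2) l ->
      continuous (fun p => block_val qz qx (zN p) x b).
    apply: (@block_val_continuous N (fun=> qz) (fun=> qx) zN (fun=> x)) => //.
    - by move=> j; exact: cst.
    - by move=> j; exact: cst.
    - exact: cst.
  have cbase : continuous (fun p => base_pt (zN p) x).
    apply: set_type_continuous => p /=.
    rewrite /continuous_at -[eta _ _](block_val0 qz qx).
    have -> : (fun p => eta (zN p) x) = (fun p => block_val qz qx (zN p) x ([::], [::])).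
      by apply/funext => p'; rewrite block_val0.
    by apply: cblk; [case: (k)|case: (l)].
  have HG := @Cspace_jet_evaluation K E F S _ N G (fun p => g (val p)) _ n
    (fun p => base_pt (zN p) x) (fun p => [seq block_val qz qx (zN p) x b | b <- t.2]) p0
    cN FG Gp0 nlk' qG cbase.
  have {}HG : (fun p : N => jet (g (val p)) n (base_pt (zN p) x)
      [seq block_val qz qx (zN p) x b | b <- t.2]) @ G -->
      term_val qz qx z x (rcons t.1 i, t.2).
    rewrite z0 in HG; rewrite /term_val; apply: HG => j ltj p.
    rewrite /continuous_at (nth_map ([::], [::]))//.
    under eq_fun do rewrite (nth_map ([::], [::]))//.
    have /andP[b1 b2] := tb _ (mem_nth ([::], [::]) ltj).
    by apply: cblk; [exact: le_smoothW ak'|exact: le_smoothW cl].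
  move=> U nU; have GU := HG U nU.
  change (\forall h \near (0 : K)^', forall p : N, val p = h ->
    U (jet (g (val p)) n (base_pt (zN p) x) [seq block_val qz qx (zN p) x b | b <- t.2])) in GU.
  have nN : \forall h \near (0 : K)^', N h.
    apply: nbhs_dnbhs; apply/near_abs_lt; exists (r / 2); first by rewrite divr_gt0.
    by move=> h; rewrite /N /= in_itv /= -ler_norml => /ltW.
  change (\forall h \near (0 : K)^', U (ajet (g h) n (e h) (vs h))).
  apply: filterS2 GU nN => h GUh Nh.
  have := GUh (SigSub (mem_set Nh)) erefl.
  rewrite /= (eE h (NA (SigSub (mem_set Nh)))) ajetE.
  rewrite (_ : vs h = [seq block_val qz qx (zN (SigSub (mem_set Nh))) x b | b <- t.2])//.
  by apply: eq_map => b; exact: (vE h (NA (SigSub (mem_set Nh)))).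
have dE : term_val qz qx z x (rcons t.1 i, t.2) + d =
    \sum_(t' <- step (inl i) t) term_val qz qx z x t'.
  rewrite /d /step /= !big_cons big_map; congr (_ + (_ + _)).
    rewrite /term_val /= size_rcons map_rcons; congr (jet _ _ _ (rcons _ _)).
    exact: eq_map.
  rewrite (@slot_sum_insertions _ _ _ _ v _ u (add_letter (inl i)) [::] t.2 v0 (fun _ => erefl)).
  apply: eq_big_seq => cs /insertions_size szcs.
  by rewrite (ajetE f n (base_pt z x)) /term_val /= szcs.
rewrite -dE; apply/has_dderiv_curve0.
pose phi (h : K) := ajet (('valL_ 0 (gamma_jet qz t.1) (val z + h *: w) :
    Cspace (add_smooth l k) S F)) n (e h) (vs h).
apply: (@curve_deriv0_eq_near _ _ phi).
  apply: filterS nA => h Ah; rewrite /phi (eE h Ah) ajetE !(valL_at _ (interior_subset Ah)).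
  rewrite /term_val; congr (jet _ _ _ _); apply: eq_map => b; exact: vE.
rewrite /curve_deriv0; apply: (cvg_trans _ (cvg_add _ H1 H)); apply: near_eq_cvg.
apply: nbhs_dnbhs; apply: filterS nA => h Ah.
have phi0 : phi 0 = ajet f n (e 0) (vs 0).
  by rewrite /phi scale0r addr0 (valLE (gamma_jet qz t.1) z).
rewrite phi0 /phi (eE h Ah) !ajetE /g.
rewrite Cspace_scale (jet_scale regS _ _ _ (CspaceP _) nlk').
rewrite Cspace_sub (jet_sub regS _ _ (CspaceP _) (CspaceP _) nlk').
by rewrite -scalerDr addrA subrK.
Qed.

Lemma word_val_xderiv qz qx w z (x : R) i :
  le_smooth (zdeg w) k -> le_smooth (xdeg w).+1 l -> R° (val x) ->
  has_dderiv ('valL_ 0 (word_val qz qx w z)) (val x) (qx i)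
    (word_val qz qx (rcons w (inr i)) z x).
Proof.
move=> wk wl Rx; rewrite /word_val terms_rcons big_flatten big_map.
apply: has_dderiv_valL_sum => // t tw.
exact: (@term_val_xderiv qz qx z x t i _ _ wk wl (terms_bound tw) Rx).
Qed.

Lemma word_val_zderiv qz qx w (z : A) x i :
  le_smooth (zdeg w).+1 k -> le_smooth (xdeg w) l -> A° (val z) ->
  has_dderiv ('valL_ 0 (fun z => word_val qz qx w z x)) (val z) (qz i)
    (word_val qz qx (rcons w (inl i)) z x).
Proof.
move=> wk wl Az; rewrite /word_val terms_rcons big_flatten big_map.
apply: has_dderiv_valL_sum => // t tw.
exact: (@term_val_zderiv qz qx z x t i _ _ wk wl (terms_bound tw) Az).
Qed.

Lemma word_val_qx qz qx qx' w z x : xdeg w = 0%N ->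
  word_val qz qx w z x = word_val qz qx' w z x.
Proof.
move=> w0; apply: eq_big_seq => t /terms_bound/and3P[_ _ /allP tb].
rewrite /term_val; congr (jet _ _ _ _); apply/eq_in_map => b /tb /andP[_].
by rewrite w0 leqn0 /block_val => /nilP ->.
Qed.

Definition word_ext qz qx w (z : Z) (x : X) : F :=
  'valL_ 0 (fun z => 'valL_ 0 (word_val qz qx w z) x) z.

Lemma word_extE qz qx w (z : A) (x : R) :
  word_ext qz qx w (val z) (val x) = word_val qz qx w z x.
Proof. by rewrite /word_ext valLE valLE. Qed.

Lemma word_ext_at qz qx w (z : Z) (x : X) (Az : A z) (Rx : R x) :
  word_ext qz qx w z x =
  word_val qz qx w (SigSub (mem_set Az)) (SigSub (mem_set Rx)).
Proof. exact: (word_extE qz qx w (SigSub (mem_set Az)) (SigSub (mem_set Rx))). Qed.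

(** A compact neighbourhood of the parameter [p0] is a test space, so k-continuity becomes
    continuity at [p0]. *)
Lemma word_ext_continuous (T : topologicalType) (N : set T) (p0 : T)
    (pz : T -> nat -> Z) (px : T -> nat -> X) (z : T -> Z) (x : T -> X) w :
  le_smooth (zdeg w) k -> le_smooth (xdeg w) l ->
  compact N -> nbhs p0 N -> (forall p, N p -> A (z p) /\ R (x p)) ->
  (forall i, continuous (fun p => pz p i)) ->
  (forall i, continuous (fun p => px p i)) -> continuous z -> continuous x ->
  {for p0, continuous (fun p => word_ext (pz p) (px p) w (z p) (x p))}.
Proof.
move=> wk wl cN nN NAR cpz cpx cz cx.
have cval : continuous (val : N -> T) by exact: initial_continuous.
have cvalN (V : topologicalType) (f : T -> V) : continuous f ->
    continuous (fun p : N => f (val p)).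
  by move=> cf p; apply: continuous_comp; [exact: cval|exact: cf].
pose zN (p : N) : A := SigSub (mem_set (NAR _ (set_mem (valP p))).1).
pose xN (p : N) : R := SigSub (mem_set (NAR _ (set_mem (valP p))).2).
have czN : continuous zN by apply: set_type_continuous; exact: cvalN.
have cxN : continuous xN by apply: set_type_continuous; exact: cvalN.
have := @word_val_continuous N (fun p => pz (val p)) (fun p => px (val p)) zN xN
  (fun i => cvalN _ _ (cpz i)) (fun i => cvalN _ _ (cpx i)) czN cxN
  (or_introl (compact_set_type cN)) w wk wl.
pose p0' : N := SigSub (mem_set (nbhs_singleton nN)).
move=> /(_ p0') cw U; rewrite /prop_for.
have -> : word_ext (pz p0) (px p0) w (z p0) (x p0) =
    word_val (pz (val p0')) (px (val p0')) w (zN p0') (xN p0').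
  exact: (word_extE _ _ w (zN p0') (xN p0')).
move=> /cw[_ [[W oW <-] Wp WU]].
have nW : nbhs p0 W by exact: open_nbhs_nbhs.
change (nbhs p0 [set p | U (word_ext (pz p) (px p) w (z p) (x p))]).
have nN' := nN; apply: filterS2 nW nN' => p Wp' Np.
have := WU (SigSub (mem_set Np)) Wp'.
by rewrite /preimage /= -(word_extE _ _ w (zN _) (xN _)).
Qed.

Lemma word_ext_xderiv qz qx w (z : Z) (x : X) i :
  le_smooth (zdeg w) k -> le_smooth (xdeg w).+1 l -> A z -> R° x ->
  has_dderiv (word_ext qz qx w z) x (qx i) (word_ext qz qx (rcons w (inr i)) z x).
Proof.
move=> wk wl Az Rx; pose z' : A := SigSub (mem_set Az).
pose x' : R := SigSub (mem_set (interior_subset Rx)).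
rewrite (word_ext_at _ _ _ Az (interior_subset Rx)).
have -> : word_ext qz qx w z = 'valL_ 0 (word_val qz qx w z').
  by apply/funext => y; rewrite /word_ext (valL_at _ Az).
exact: (@word_val_xderiv qz qx w z' x' i wk wl Rx).
Qed.

Lemma word_ext_zderiv qz qx w (z : Z) (x : X) i :
  le_smooth (zdeg w).+1 k -> le_smooth (xdeg w) l -> A° z -> R x ->
  has_dderiv (word_ext qz qx w ^~ x) z (qz i) (word_ext qz qx (rcons w (inl i)) z x).
Proof.
move=> wk wl Az Rx; pose z' : A := SigSub (mem_set (interior_subset Az)).
pose x' : R := SigSub (mem_set Rx).
rewrite (word_ext_at _ _ _ (interior_subset Az) Rx).
have -> : word_ext qz qx w ^~ x = 'valL_ 0 (fun z => word_val qz qx w z x').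
  apply/funext => y; rewrite /word_ext; congr ('valL_ 0 _ y).
  by apply/funext => z0; rewrite (valL_at _ Rx).
exact: (@word_val_zderiv qz qx w z' x' i wk wl Az).
Qed.

Lemma word_ext_swap qz qx w (z : Z) (x : X) i j :
  le_smooth (zdeg w).+1 k -> le_smooth (xdeg w).+1 l -> A° z -> R° x ->
  word_ext qz qx (rcons (rcons w (inl i)) (inr j)) z x =
  word_ext qz qx (rcons (rcons w (inr j)) (inl i)) z x.
Proof.
move=> wk wl Az Rx.
have nz : \forall s \near (0 : K), A° (z + s *: qz i).
  by apply: near_shift => //; exact: open_interior.
have nx : \forall s \near (0 : K), R° (x + s *: qx j).
  by apply: near_shift => //; exact: open_interior.
have [N1 [cN1 nN1 N1A]] := compact_nbhs0 nz.
have [N2 [cN2 nN2 N2R]] := compact_nbhs0 nx.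
have nzx : \forall p \near ((0, 0) : K * K), A° (z + p.1 *: qz i) /\ R° (x + p.2 *: qx j).
  by exists (N1, N2) => // -[s t] [/= /N1A ? /N2R].
have cont w' : le_smooth (zdeg w') k -> le_smooth (xdeg w') l ->
    {for (0, 0), continuous (fun p : K * K =>
      word_ext qz qx w' (z + p.1 *: qz i) (x + p.2 *: qx j))}.
  move=> w'k w'l.
  apply: (@word_ext_continuous (K * K)%type (N1 `*` N2) (0, 0) (fun=> qz) (fun=> qx)) => //.
  - exact: compact_setX.
  - by exists (N1, N2).
  - by move=> -[s t] [/= /N1A/interior_subset ? /N2R/interior_subset].
  - by move=> i'; exact: cst_continuous.
  - by move=> i'; exact: cst_continuous.
  - by apply: line_continuous => p; exact: cvg_fst.
  - by apply: line_continuous => p; exact: cvg_snd.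
have := @mixed_partials_eq K F
  (fun s t : K => word_ext qz qx w (z + s *: qz i) (x + t *: qx j))
  (fun s t : K => word_ext qz qx (rcons w (inl i)) (z + s *: qz i) (x + t *: qx j))
  (fun s t : K => word_ext qz qx (rcons w (inr j)) (z + s *: qz i) (x + t *: qx j))
  (fun s t : K => word_ext qz qx (rcons (rcons w (inl i)) (inr j)) (z + s *: qz i) (x + t *: qx j))
  (fun s t : K => word_ext qz qx (rcons (rcons w (inr j)) (inl i)) (z + s *: qz i) (x + t *: qx j)).
rewrite !scale0r !addr0; apply.
- apply: filterS nzx => -[s t] /= [Az' Rx']; split.
  + apply/(has_dderiv_line (word_ext qz qx w ^~ _)).
    by apply: word_ext_zderiv => //; [exact: le_smoothW wl|exact: interior_subset].
  + apply/(has_dderiv_line (word_ext qz qx (rcons w (inl i)) _)).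
    by apply: word_ext_xderiv; rewrite ?zdeg_rcons ?xdeg_rcons ?addn0 ?addn1//; exact: interior_subset.
  + apply/(has_dderiv_line (word_ext qz qx w _)).
    by apply: word_ext_xderiv => //; [exact: le_smoothW wk|exact: interior_subset].
  + apply/(has_dderiv_line (word_ext qz qx (rcons w (inr j)) ^~ _)).
    by apply: word_ext_zderiv; rewrite ?zdeg_rcons ?xdeg_rcons ?addn0 ?addn1//; exact: interior_subset.
- by apply: cont; rewrite !(zdeg_rcons, xdeg_rcons) /= ?addn0 ?addn1.
- by apply: cont; rewrite !(zdeg_rcons, xdeg_rcons) /= ?addn0 ?addn1.
Qed.

(* The last [Z]-letter is moved in front of the [X]-letters one swap at a time;
   after each swap both sides are differentiated along the remaining letter. *)
Lemma word_ext_move qz qx u (js : seq nat) i (z : Z) (x : X) :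
  le_smooth (zdeg u).+1 k -> le_smooth (xdeg u + size js) l -> A° z -> R° x ->
  word_ext qz qx (rcons (u ++ map inr js) (inl i)) z x =
  word_ext qz qx (rcons u (inl i) ++ map inr js) z x.
Proof.
elim/last_ind: js z x => [|js j IH] z x uk ul Az Rx; first by rewrite !cats0.
rewrite size_rcons addnS in ul; have ul' := le_smoothW (leqnSn _) ul.
rewrite map_rcons -!rcons_cat -word_ext_swap//; last 2 first.
- by rewrite zdeg_cat zdeg_inr addn0.
- by rewrite xdeg_cat xdeg_inr.
have d1 : has_dderiv (word_ext qz qx (rcons (u ++ map inr js) (inl i)) z) x (qx j)
    (word_ext qz qx (rcons (rcons (u ++ map inr js) (inl i)) (inr j)) z x).
  apply: word_ext_xderiv => //; last exact: interior_subset.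
    by rewrite zdeg_rcons zdeg_cat zdeg_inr addn0 addn1.
  by rewrite xdeg_rcons xdeg_cat xdeg_inr /= addn0.
have d2 : has_dderiv (word_ext qz qx (rcons u (inl i) ++ map inr js) z) x (qx j)
    (word_ext qz qx (rcons (rcons u (inl i) ++ map inr js) (inr j)) z x).
  apply: word_ext_xderiv => //; last exact: interior_subset.
    by rewrite zdeg_cat zdeg_rcons zdeg_inr addn0 addn1.
  by rewrite xdeg_cat xdeg_rcons xdeg_inr /= addn0.
apply: (has_dderiv_unique _ d2).
apply: (has_dderiv_eq_open (@open_interior _ R) Rx _ d1) => y Ry.
exact: IH.
Qed.

(** For fixed [z] both sides are continuous on all of [R], so the identity at interior points
    extends to the boundary of [R] by density. *)
Lemma word_val_move qz qx u (js : seq nat) i (z : A) (x : R) :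
  le_smooth (zdeg u).+1 k -> le_smooth (xdeg u + size js) l -> A° (val z) ->
  word_val qz qx (rcons (u ++ map inr js) (inl i)) z x =
  word_val qz qx (rcons u (inl i) ++ map inr js) z x.
Proof.
move=> uk ul Az.
suff /(congr1 (@^~ x)) : word_val qz qx (rcons (u ++ map inr js) (inl i)) z =
  word_val qz qx (rcons u (inl i) ++ map inr js) z by [].
have cont w : le_smooth (zdeg w) k -> le_smooth (xdeg w) l ->
    continuous (word_val qz qx w z).
  apply: (@word_val_continuous R (fun=> qz) (fun=> qx) (fun=> z) id).
  - by move=> j; exact: cst_continuous.
  - by move=> j; exact: cst_continuous.
  - exact: cst_continuous.
  - by move=> y U.
  - by right.
apply: continuous_eq_interior => //.
- by apply: cont; rewrite ?zdeg_rcons ?xdeg_rcons ?zdeg_cat ?xdeg_cat ?zdeg_inr ?xdeg_inr /= ?addn0 ?addn1.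
- by apply: cont; rewrite ?zdeg_cat ?xdeg_cat ?zdeg_rcons ?xdeg_rcons ?zdeg_inr ?xdeg_inr /= ?addn0 ?addn1.
- by move=> y Ry; rewrite -!word_extE; exact: word_ext_move.
Qed.

(** * Slices at fixed z as elements of C^l(R, F) *)

Section slices.
Variables (qz : nat -> Z) (w : seq letter) (z : A).
Hypotheses (wk : le_smooth (zdeg w) k) (w0 : xdeg w = 0%N).
Local Notation slice := (word_val qz (fun=> 0) w z).

(** As [w] contains no letter of X, the sequence [fun=> 0] in [slice] is a dummy that [word_val_qx]
    exchanges for [qx]. Each derivative in [x] then appends a letter to the word. *)
Lemma slice_iter_dderiv qx i x : le_smooth i l -> R° x ->
  iter_dderiv (map qx (iota 0 i)) ('valL_ 0 slice) x =
  word_ext qz qx (w ++ xword i) (val z) x.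
Proof.
elim: i x => [|i IH] x il Rx.
  rewrite cats0 (word_ext_at _ _ _ (set_mem (valP z)) (interior_subset Rx)).
  change ('valL_ 0 slice x = word_val qz qx w (SigSub (mem_set (set_mem (valP z))))
    (SigSub (mem_set (interior_subset Rx)))).
  rewrite (valL_at _ (interior_subset Rx)) (word_val_qx _ _ qx)//.
  by congr (word_val _ _ _ _ _); exact: val_inj.
rewrite iotaS_rcons map_rcons /iter_dderiv foldl_rcons xwordS -rcons_cat.
apply: dderivP; apply: (has_dderiv_eq_open (f := word_ext qz qx (w ++ xword i) (val z))
  (@open_interior _ R) Rx).
  by move=> y Ry; rewrite -IH//; exact: le_smoothW il.
apply: word_ext_xderiv => //; last exact: set_mem (valP z).
  by rewrite zdeg_cat zdeg_xword addn0.
by rewrite xdeg_cat xdeg_xword w0.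
Qed.

Lemma slice_jet_continuous i : le_smooth i l ->
  continuous (fun p : R * {ptws 'I_i -> X} =>
    word_val qz (nth 0 (codom p.2)) (w ++ xword i) z p.1).
Proof.
move=> il; apply: (@word_val_continuous (R * {ptws 'I_i -> X})%type (fun=> qz)
  (fun p => nth 0 (codom p.2)) (fun=> z) fst).
- by move=> j; exact: cst_continuous.
- move=> j [y1 y2]; exact: (cvg_comp _ _ (@cvg_snd _ _ (nbhs y1) (nbhs y2) _)
    (@nth_codom_continuous K X i j y2)).
- exact: cst_continuous.
- by move=> p; exact: cvg_fst.
- by right.
- by rewrite zdeg_cat zdeg_xword addn0.
- by rewrite xdeg_cat xdeg_xword w0.
Qed.

Lemma slice_djet_ext i : le_smooth i l ->
  djet_ext slice (fun p : R * {ptws 'I_i -> X} =>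
    word_val qz (nth 0 (codom p.2)) (w ++ xword i) z p.1).
Proof.
move=> il; split; first exact: slice_jet_continuous.
move=> x y Rx; rewrite /djet -(map_nth_codom 0 y) slice_iter_dderiv// word_extE.
by rewrite map_nth_codom.
Qed.

Lemma slice_isC : isC l slice.
Proof.
have l0 : le_smooth 0 l by case: (l).
split.
  have -> : slice = (fun p : R * {ptws 'I_0 -> X} =>
    word_val qz (nth 0 (codom p.2)) (w ++ xword 0) z p.1) \o (fun x => (x, fun=> 0)).
    by apply/funext => x; rewrite /= cats0; exact: word_val_qx.
  move=> x; apply: continuous_comp; last exact: slice_jet_continuous.
  by move=> U [[A' B] /= [nA nB] AB]; apply: filterS nA => y Ay; apply: (AB (_, _)); split=> //;
      exact: nbhs_singleton.
move=> i il; split; last by eexists; exact: slice_djet_ext.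
move=> ys y szi x Rx; move: il; rewrite -szi size_rcons => il.
pose qx := nth 0 (rcons ys y).
have ysE : ys = map qx (iota 0 (size ys)).
  apply: (@eq_from_nth _ 0); first by rewrite size_map size_iota.
  by move=> n ltn; rewrite (nth_map 0%N) ?size_iota// nth_iota// /qx nth_rcons ltn.
have yE : y = qx (size ys) by rewrite /qx nth_rcons ltnn eqxx.
exists (word_ext qz qx (rcons (w ++ xword (size ys)) (inr (size ys))) (val z) x).
rewrite {1}ysE {1}yE; apply: (has_dderiv_eq_open (f := word_ext qz qx (w ++ xword (size ys)) (val z))
  (@open_interior _ R) Rx).
  by move=> x' Rx'; rewrite slice_iter_dderiv//; exact: le_smoothW il.
apply: word_ext_xderiv => //; last exact: set_mem (valP z).
  by rewrite zdeg_cat zdeg_xword addn0.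
by rewrite xdeg_cat xdeg_xword w0.
Qed.

End slices.

(** * Derivatives of zeta with values in C^l(R, F) *)

Lemma zslice_isC qz j (jk : le_smooth j k) z :
  isC l (word_val qz (fun=> 0) (zword j) z).
Proof. by apply: slice_isC; rewrite ?zdeg_zword ?xdeg_zword. Qed.

(* The derivative d^(j) of the composition map at [z] in the directions
   [qz 0], ..., [qz (j - 1)], as an element of C^l(R, F). *)
Definition zslice j (jk : le_smooth j k) qz (z : A) : Cspace l R F :=
  toC (zslice_isC qz jk z).

Lemma djet_map_zslice j (jk : le_smooth j k) qz z i : le_smooth i l ->
  djet_map (zslice jk qz z) i = (fun p : R * {ptws 'I_i -> X} =>
    word_val qz (nth 0 (codom p.2)) (zword j ++ xword i) z p.1).
Proof.
move=> il; apply: (djet_map_unique (@lcs_hausdorff K F) regR).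
by apply: slice_djet_ext => //; rewrite ?zdeg_zword ?xdeg_zword.
Qed.

(** The topology is tested on the derivatives of each order [i] in [x], to which
    [compact_open_deriv] applies. Differentiating them in [z] puts the new letter of Z behind the
    letters of X, whereas the jets of the next slice have it in front; [word_val_move] reconciles
    the two. *)
Lemma has_dderiv_zslice j (jk : le_smooth j k) (jk1 : le_smooth j.+1 k) qz (z : A) :
  A° (val z) ->
  has_dderiv ('valL_ 0 (zslice jk qz)) (val z) (qz j) (zslice jk1 qz z).
Proof.
move=> Az; apply/Cspace_cvgP => i il.
rewrite (djet_map_zslice jk1 qz z il).
pose G j' (h : K) (p : R * {ptws 'I_i -> X}) :=
  word_ext qz (nth 0 (codom p.2)) (zword j' ++ xword i) (val z + h *: qz j) (val p.1).
have zw j' : zdeg (zword j' ++ xword i) = j'.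
  by rewrite zdeg_cat zdeg_zword zdeg_xword addn0.
have xw j' : xdeg (zword j' ++ xword i) = i.
  by rewrite xdeg_cat xdeg_zword xdeg_xword.
have nA : \forall h \near (0 : K), A° (val z + h *: qz j).
  by apply: near_shift => //; exact: open_interior.
have GE j' h (Ah : A° (val z + h *: qz j)) p :
    G j' h p = word_val qz (nth 0 (codom p.2)) (zword j' ++ xword i)
      (SigSub (mem_set (interior_subset Ah))) p.1.
  exact: (word_extE _ _ _ (SigSub (mem_set (interior_subset Ah))) p.1).
have G0 j' : G j' 0 = (fun p => word_val qz (nth 0 (codom p.2)) (zword j' ++ xword i) z p.1).
  by apply/funext => p; rewrite /G scale0r addr0 word_extE.
rewrite -G0.
have H1 : \forall s \near (0 : K), forall p, curve_deriv (G j ^~ p) s (G j.+1 s p).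
  apply: filterS nA => s As p.
  have -> : G j.+1 s p = word_ext qz (nth 0 (codom p.2))
      (rcons (zword j ++ xword i) (inl j)) (val z + s *: qz j) (val p.1).
    rewrite (GE _ s As) zwordS -word_val_move//; last 2 first.
    - by rewrite zdeg_zword.
    - by rewrite xdeg_zword size_iota.
    exact/esym/(word_extE _ _ _ (SigSub (mem_set (interior_subset As))) p.1).
  apply/(has_dderiv_line (word_ext qz _ _ ^~ (val p.1))).
  apply: word_ext_zderiv => //; rewrite ?zw ?xw//.
  exact: set_mem (valP p.1).
have H2 (C : set (R * {ptws 'I_i -> X})) (x : C) : compact C ->
    {for (0, x), continuous (fun p : K * C => G j.+1 p.1 (val p.2))}.
  move=> cC; have [N [cN nN NA]] := compact_nbhs0 nA.
  have c1 : continuous (fun p : K * C => p.1) by move=> [p1 p2]; exact: cvg_fst.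
  have c2 : continuous (fun p : K * C => val p.2).
    move=> [p1 p2]; exact: (cvg_comp _ _ (@cvg_snd _ _ (nbhs p1) (nbhs p2) _)
      (@initial_continuous C _ val p2)).
  have c21 : continuous (fun p : K * C => (val p.2).1).
    by move=> p; exact: (cvg_comp _ _ (c2 p) (@cvg_fst _ _ (nbhs (val p.2).1) (nbhs (val p.2).2) _)).
  have c22 : continuous (fun p : K * C => (val p.2).2).
    by move=> p; exact: (cvg_comp _ _ (c2 p) (@cvg_snd _ _ (nbhs (val p.2).1) (nbhs (val p.2).2) _)).
  apply: (@word_ext_continuous (K * C)%type (N `*` setT) (0, x) (fun=> qz)
    (fun p => nth 0 (codom (val p.2).2)) (fun p => val z + p.1 *: qz j)
    (fun p => val (val p.2).1)).
  - by rewrite zw.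
  - by rewrite xw.
  - by apply: compact_setX => //; exact: compact_set_type.
  - by exists (N, setT) => //; split=> //; exact: filterT.
  - move=> [s y] [/= /NA/interior_subset As _]; split=> //.
    exact: set_mem (valP (val y).1).
  - by move=> j'; exact: cst_continuous.
  - by move=> j' p; exact: (cvg_comp _ _ (c22 p) (@nth_codom_continuous K X i j' _)).
  - exact: line_continuous.
  - by move=> p; exact: (cvg_comp _ _ (c21 p) (@initial_continuous R X val _)).
have H := compact_open_deriv H1 H2.
move=> U nU; have HU := H U nU.
change (\forall h \near (0 : K)^', U (h^-1 *: (G j h - G j 0))) in HU.
change (\forall h \near (0 : K)^', U (djet_map (h^-1 *:
  ('valL_ 0 (zslice jk qz) (val z + h *: qz j) - 'valL_ 0 (zslice jk qz) (val z)) : Cspace l R F) i)).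
have nA' : \forall h \near (0 : K)^', A° (val z + h *: qz j) by exact: nbhs_dnbhs.
apply: filterS2 HU nA' => h Uh Ah.
rewrite (valL_at _ (interior_subset Ah)) (valLE (zslice jk qz) z).
rewrite Cspace_scale Cspace_sub (djet_map_scale_sub regR _ (CspaceP (_ - _)) (CspaceP _) (CspaceP _) il).
rewrite !djet_map_zslice//.
suff -> : (fun p : R * {ptws 'I_i -> X} => h^-1 *:
   (word_val qz (nth 0 (codom p.2)) (zword j ++ xword i) (SigSub (mem_set (interior_subset Ah))) p.1
    - word_val qz (nth 0 (codom p.2)) (zword j ++ xword i) z p.1)) = h^-1 *: (G j h - G j 0) by [].
by apply/funext => p; rewrite -(GE j h Ah) G0.
Qed.

Lemma le_smooth0 (m : smoothness) : le_smooth 0 m.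
Proof. by case: m. Qed.

Definition zeta : A -> Cspace l R F := zslice (le_smooth0 k) (fun=> 0).

Lemma zetaE z x : zeta z x = gamma z (base_pt z x).
Proof. exact: word_val0. Qed.

Lemma zslice0 (jk : le_smooth 0 k) qz z : zslice jk qz z = zeta z.
Proof.
by apply: val_inj; apply/funext => x; exact: etrans (word_val0 _ _ _ _) (esym (zetaE z x)).
Qed.

Lemma zeta_iter_dderiv qz j (jk : le_smooth j k) z : A° z ->
  iter_dderiv (map qz (iota 0 j)) ('valL_ 0 zeta) z = 'valL_ 0 (zslice jk qz) z.
Proof.
elim: j jk z => [|j IH] jk z Az.
  rewrite (valL_at _ (interior_subset Az)) zslice0.
  exact: (valL_at zeta (interior_subset Az)).
have jk' : le_smooth j k by exact: le_smoothW jk.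
rewrite iotaS_rcons map_rcons /iter_dderiv foldl_rcons.
apply: (dderiv_unique (Cspace_hausdorff regR)).
rewrite (valL_at _ (interior_subset Az)).
apply: (has_dderiv_eq_open (f := 'valL_ 0 (zslice jk' qz)) (@open_interior _ A) Az).
  by move=> y Ay; rewrite -IH.
pose z' : A := SigSub (mem_set (interior_subset Az)).
have H := @has_dderiv_zslice _ jk' jk qz z' Az.
exact: H.
Qed.

Lemma map_nth_iota (ys : seq Z) : ys = map (nth 0 ys) (iota 0 (size ys)).
Proof. by rewrite -[LHS](mkseq_nth 0). Qed.

Lemma zeta_has_dderiv ys v z : le_smooth (size ys).+1 k -> A° z ->
  has_dderiv (iter_dderiv ys ('valL_ 0 zeta)) z v
    (iter_dderiv (rcons ys v) ('valL_ 0 zeta) z).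
Proof.
move=> jk Az; have jk' : le_smooth (size ys) k by exact: le_smoothW jk.
pose qz := nth 0 (rcons ys v).
have ysE : ys = map qz (iota 0 (size ys)).
  apply: (@eq_from_nth _ 0); first by rewrite size_map size_iota.
  by move=> n ltn; rewrite (nth_map 0%N) ?size_iota// nth_iota// /qz nth_rcons ltn.
have vE : v = qz (size ys) by rewrite /qz nth_rcons ltnn eqxx.
have rE : rcons ys v = map qz (iota 0 (size ys).+1).
  by rewrite iotaS_rcons map_rcons -ysE -vE.
rewrite rE (zeta_iter_dderiv qz jk Az) {1}ysE {1}vE.
apply: (has_dderiv_eq_open (f := 'valL_ 0 (zslice jk' qz)) (@open_interior _ A) Az).
  by move=> y Ay; rewrite zeta_iter_dderiv.
rewrite (valL_at _ (interior_subset Az)).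
pose z' : A := SigSub (mem_set (interior_subset Az)).
have H := @has_dderiv_zslice _ jk' jk qz z' Az.
exact: H.
Qed.

(** * Multilinearity and symmetry by evaluation at points of R *)

Lemma has_dderiv_eval (f : Z -> Cspace l R F) (z v : Z) (d : Cspace l R F) (x : R) :
  has_dderiv f z v d -> has_dderiv (fun z => f z x) z v (d x).
Proof.
move=> fd; have FF : Filter (0 : K)^' by exact: _.
have H := @Cspace_eval_cvg K X F R l regR K 0^'
  (fun h => h^-1 *: (f (z + h *: v) - f z)) d x FF fd.
rewrite /has_dderiv; apply: (cvg_trans _ H); apply: near_eq_cvg; apply: nearW => h.
by rewrite Cspace_scale Cspace_sub.
Qed.

Section evaluation.
Variable x : R.
Let phi (z : Z) : F := ('valL_ 0 zeta z : Cspace l R F) x.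

(** Evaluation at [x] is linear and continuous, so it commutes with derivatives. It reduces
    identities in [Cspace l R F] to identities for maps into [F], where the results on symmetric
    derivatives apply. *)
Lemma iter_dderiv_eval ys z : le_smooth (size ys) k -> A° z ->
  iter_dderiv ys phi z = (iter_dderiv ys ('valL_ 0 zeta) z : Cspace l R F) x.
Proof.
elim/last_ind: ys z => [//|ys v IH] z; rewrite size_rcons => jk Az.
rewrite {1}/iter_dderiv foldl_rcons; apply: dderivP.
apply: (has_dderiv_eq_open
  (f := fun z => (iter_dderiv ys ('valL_ 0 zeta) z : Cspace l R F) x) (@open_interior _ A) Az).
  by move=> y Ay; rewrite -IH//; exact: le_smoothW jk.
apply: (has_dderiv_eval (f := iter_dderiv ys ('valL_ 0 zeta)) (x := x)).
by apply: zeta_has_dderiv.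
Qed.

Lemma eval_has_dderiv ys v z : le_smooth (size ys).+1 k -> A° z ->
  has_dderiv (iter_dderiv ys phi) z v (iter_dderiv (rcons ys v) phi z).
Proof.
move=> jk Az; rewrite iter_dderiv_eval ?size_rcons//.
apply: (has_dderiv_eq_open
  (f := fun z => (iter_dderiv ys ('valL_ 0 zeta) z : Cspace l R F) x) (@open_interior _ A) Az).
  by move=> y Ay; rewrite -iter_dderiv_eval//; exact: le_smoothW jk.
apply: (has_dderiv_eval (f := iter_dderiv ys ('valL_ 0 zeta)) (x := x)).
by apply: zeta_has_dderiv.
Qed.

Lemma eval_plane_continuous ys z v w : le_smooth (size ys) k -> A° z ->
  {for (0, 0), continuous (fun p : K * K => iter_dderiv ys phi (z + p.1 *: v + p.2 *: w))}.
Proof.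
move=> jk Az.
have yE y : A° y -> iter_dderiv ys phi y =
    word_ext (nth 0 ys) (fun=> 0) (zword (size ys)) y (val x).
  move=> Ay; rewrite iter_dderiv_eval// {1}(map_nth_iota ys) (zeta_iter_dderiv _ jk Ay).
  rewrite (valL_at _ (interior_subset Ay)).
  exact/esym/(word_extE _ _ _ (SigSub (mem_set (interior_subset Ay))) x).
have nA : \forall p \near ((0, 0) : K * K), A° (z + p.1 *: v + p.2 *: w).
  exact: (@plane_cvg K Z z v w A° (open_nbhs_nbhs (conj (@open_interior _ A) Az))).
have [d d0 dA] := near_pair_lt (P := fun s t : K => A° (z + s *: v + t *: w)) nA.
have [|N [cN nN NA]] := @compact_nbhs0 K [set h | `|h| < d].
  by apply/near_abs_lt; exists d.
have cw : {for (0, 0), continuous (fun p : K * K =>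
    word_ext (nth 0 ys) (fun=> 0) (zword (size ys)) (z + p.1 *: v + p.2 *: w) (val x))}.
  apply: (@word_ext_continuous (K * K)%type (N `*` N) (0, 0) (fun=> nth 0 ys)
    (fun=> fun=> 0) (fun p => z + p.1 *: v + p.2 *: w) (fun=> val x)).
  - by rewrite zdeg_zword.
  - by rewrite xdeg_zword le_smooth0.
  - exact: compact_setX.
  - by exists (N, N).
  - move=> [s t] [/= /NA sd /NA td]; split; first exact: interior_subset (dA _ _ sd td).
    exact: set_mem (valP x).
  - by move=> i; exact: cst_continuous.
  - by move=> i; exact: cst_continuous.
  - move=> [s t]; apply: (cvg_add _ (cvg_add _ (@cst_continuous _ _ z (s, t)) _) _).
      exact: (cvg_scalel _ (@cvg_fst _ _ (nbhs s) (nbhs t) _) (@cst_continuous _ _ v (s, t))).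
    exact: (cvg_scalel _ (@cvg_snd _ _ (nbhs s) (nbhs t) _) (@cst_continuous _ _ w (s, t))).
  - exact: cst_continuous.
move=> U nU; have A0 := nbhs_singleton nA.
change (nbhs (iter_dderiv ys phi (z + (0 : K) *: v + (0 : K) *: w)) U) in nU.
rewrite (yE _ A0) in nU; have nU' := cw U nU.
change (\forall p \near ((0, 0) : K * K), U (word_ext (nth 0 ys) (fun=> 0)
  (zword (size ys)) (z + p.1 *: v + p.2 *: w) (val x))) in nU'.
change (\forall p \near ((0, 0) : K * K), U (iter_dderiv ys phi (z + p.1 *: v + p.2 *: w))).
by apply: filterS2 nU' nA => p Up Ap; rewrite (yE _ Ap).
Qed.

End evaluation.

Lemma zeta_slot us vs (a : K) e e' z : le_smooth (size us + (size vs).+1) k -> A° z ->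
  iter_dderiv (us ++ (a *: e + e') :: vs) ('valL_ 0 zeta) z =
  a *: iter_dderiv (us ++ e :: vs) ('valL_ 0 zeta) z +
  iter_dderiv (us ++ e' :: vs) ('valL_ 0 zeta) z.
Proof.
move=> jk Az; apply: val_inj; apply/funext => x /=.
have H := iter_dderiv_slot (@open_interior _ A) (@eval_has_dderiv x)
  (@eval_plane_continuous x) a e e' jk Az.
by rewrite !iter_dderiv_eval ?size_cat// in H.
Qed.

Lemma zeta_swap us vs v w z : le_smooth (size us + (size vs).+2) k -> A° z ->
  iter_dderiv (us ++ v :: w :: vs) ('valL_ 0 zeta) z =
  iter_dderiv (us ++ w :: v :: vs) ('valL_ 0 zeta) z.
Proof.
move=> jk Az; apply: val_inj; apply/funext => x /=.
have jk' : le_smooth (size us).+2 k.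
  by apply: le_smoothW jk; rewrite !addnS !ltnS leq_addr.
have H := iter_dderiv_swap (@open_interior _ A) (@eval_has_dderiv x)
  (@eval_plane_continuous x) vs v w jk' Az.
by rewrite !iter_dderiv_eval ?size_cat// in H.
Qed.

(** * Continuity on the diagonal and polarization *)

Hypothesis kAZ : kR_space K (A * Z)%type.

(** With all [j] directions equal to [q.2], the domain is [A * Z] for every [j], and [kAZ] applies.
    For each order [i] in [x] the derivative is viewed as a map into a function space, whose
    k-continuity follows by currying. *)
Lemma zslice_diag_continuous j (jk : le_smooth j k) :
  continuous (fun q : A * Z => zslice jk (fun=> q.2) q.1).
Proof.
move=> q; apply/Cspace_cvgP => i il.
pose T := (R * {ptws 'I_i -> X})%type.
pose f (q : A * Z) : {family compact, T -> F} := fun p : T =>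
  word_val (fun=> q.2) (nth 0 (codom p.2)) (zword j ++ xword i) q.1 p.1.
have fE q' : djet_map (zslice jk (fun=> q'.2) q'.1) i = f q'.
  exact: djet_map_zslice.
have cf : continuous f.
  apply: (kR_continuous kAZ) => P c cP cc.
  apply: curry_family_compact => C cC.
  have cPC : compact [set: (P * C)%type].
    by rewrite -setXTT; apply: compact_setX => //; exact: compact_set_type.
  have c1 : continuous (fun p : P * C => c p.1).
    by move=> [p1 p2]; exact: (cvg_comp _ _ (@cvg_fst _ _ (nbhs p1) (nbhs p2) _) (cc p1)).
  have c2 : continuous (fun p : P * C => val p.2).
    move=> [p1 p2]; exact: (cvg_comp _ _ (@cvg_snd _ _ (nbhs p1) (nbhs p2) _)
      (@initial_continuous C _ val p2)).
  have c22 : continuous (fun p : P * C => (val p.2).2).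
    by move=> p; exact: (cvg_comp _ _ (c2 p) (@cvg_snd _ _ (nbhs (val p.2).1) (nbhs (val p.2).2) _)).
  apply: (@word_val_continuous (P * C)%type (fun p => fun=> (c p.1).2)
    (fun p => nth 0 (codom (val p.2).2)) (fun p => (c p.1).1) (fun p => (val p.2).1)).
  - move=> n p; exact: (cvg_comp _ _ (c1 p) (@cvg_snd _ _ (nbhs (c p.1).1) (nbhs (c p.1).2) _)).
  - by move=> n p; exact: (cvg_comp _ _ (c22 p) (@nth_codom_continuous K X i n _)).
  - move=> p; exact: (cvg_comp _ _ (c1 p) (@cvg_fst _ _ (nbhs (c p.1).1) (nbhs (c p.1).2) _)).
  - move=> p; exact: (cvg_comp _ _ (c2 p)
      (@cvg_fst _ _ (nbhs (val p.2).1) (nbhs (val p.2).2) _)).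
  - by left.
  - by rewrite zdeg_cat zdeg_zword zdeg_xword addn0.
  - by rewrite xdeg_cat xdeg_zword xdeg_xword.
apply/compact_open_cvgP => C Q cC oQ CQ'.
have CQ : f q @` C `<=` Q by rewrite -fE; exact: CQ'.
(* At a continuous function, a compact-open neighbourhood is also one for uniform convergence on
   compact sets. *)
have cfq : continuous (f q : T -> F).
  by rewrite -fE; exact: (djet_mapP (CspaceP _) il).1.
have := cf q _ (fam_compact_nbhs oQ CQ cC cfq).
change (nbhs q [set q' | forall y, C y -> Q (f q' y)] ->
  nbhs q [set q' | djet_map (zslice jk (fun=> q'.2) q'.1) i @` C `<=` Q]).
apply: filterS => q' fQ _ [y Cy <-].
by have := fQ y Cy; rewrite -(congr1 (@^~ y) (fE q')).
Qed.

(** Induction on the number of directions not yet on the diagonal: [polarization_step] trades [v]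
    for one more copy of directions [u + t v], with coefficients independent of [p]. The map [g] is
    built from diagonal slices, so it is defined and continuous also where [z p] is a boundary
    point. *)
Lemma zeta_polarization (P : topologicalType) (z : P -> A) (vs : seq (P -> Z))
    (m : nat) (u : P -> Z) : le_smooth (m + size vs) k -> continuous z ->
  continuous u ->
  (forall i, (i < size vs)%N -> continuous (nth (fun=> 0) vs i)) ->
  exists g : P -> Cspace l R F, continuous g /\ forall p, A° (val (z p)) ->
    g p = iter_dderiv (nseq m (u p) ++ [seq v p | v <- vs]) ('valL_ 0 zeta) (val (z p)).
Proof.
move=> + cz; elim: vs m u => [|v vs IH] m u mk cu cvs.
  rewrite addn0 in mk; exists (fun p => zslice mk (fun=> u p) (z p)); split.
    move=> p; have czu : (fun p => (z p, u p)) @ p --> (z p, u p).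
      exact: (cvg_pair (cz p) (cu p)).
    exact: (cvg_comp _ _ czu (@zslice_diag_continuous m mk (z p, u p))).
  move=> p Az; rewrite cats0.
  have -> : nseq m (u p) = map (fun=> u p) (iota 0 m).
    by rewrite -[in LHS](size_iota 0 m) -map_nseq; elim: (iota 0 m) => //= ? ? ->.
  by rewrite (zeta_iter_dderiv _ mk Az) valLE.
have [mu muE] := polarization_step K m.
have cv : continuous v by exact: (cvs 0%N isT).
have H (t : 'I_m.+2) : exists g : P -> Cspace l R F, continuous g /\ forall p, A° (val (z p)) ->
    g p = iter_dderiv (nseq m.+1 (u p + t%:R *: v p) ++ [seq v p | v <- vs])
      ('valL_ 0 zeta) (val (z p)).
  apply: IH.
  - by rewrite addSnnS.
  - by move=> p; exact: (cvg_add _ (cu p) (cvg_scale _ (cv p))).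
  - by move=> i lti; exact: (cvs i.+1).
have [g gP] := choice H.
exists (fun p => \sum_t mu t *: g t p); split.
  by apply: (Cspace_continuous_sum regR) => t; exact: (gP t).1.
move=> p Az.
have sz : (m.+1 + size [seq v p | v <- vs])%N = (m + size (v :: vs))%N.
  by rewrite size_map addSnnS.
rewrite /= (muE _ _ (fun ys => iter_dderiv ys ('valL_ 0 zeta) (val (z p)))
  (m + size (v :: vs))%N _ _ _ _ _ sz).
- by apply: eq_bigr => t _; rewrite (gP t).2.
- by move=> us ws a e e' szu; apply: zeta_slot => //; rewrite szu.
- by move=> us v' w ws szu; apply: zeta_swap => //; rewrite szu.
Qed.

Lemma zeta_isC : isC k zeta.
Proof.
split.
  move=> z; have -> : zeta = (fun q : A * Z => zslice (le_smooth0 k) (fun=> q.2) q.1) \o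
      (fun z => (z, 0)).
    by apply/funext => z'; rewrite /= zslice0.
  apply: continuous_comp; last exact: zslice_diag_continuous.
  by move=> U [[A' B] /= [nA nB] AB]; apply: filterS nA => y Ay;
    apply: (AB (_, _)); split=> //; exact: nbhs_singleton.
move=> j jk; split.
  move=> ys y szj z Az; exists (iter_dderiv (rcons ys y) ('valL_ 0 zeta) z).
  by apply: zeta_has_dderiv => //; move: jk; rewrite -szj size_rcons.
pose vs : seq (A * {ptws 'I_j -> Z} -> Z) := [seq (fun p => p.2 i) | i <- enum 'I_j].
have szvs : size vs = j by rewrite size_map size_enum_ord.
(* No direction is on the diagonal at the start: [m = 0], so [fun=> 0] only fills the place of [u],
   and [vs] lists the coordinate projections. *)
have [||||g [cg gE]] := @zeta_polarization (A * {ptws 'I_j -> Z})%type fst vs 0 (fun=> 0).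
- by rewrite szvs.
- by move=> p; exact: cvg_fst.
- exact: cst_continuous.
- move=> i; rewrite szvs => ltij [z y].
  rewrite (nth_map (Ordinal ltij)) ?size_enum_ord//.
  exact: (cvg_comp _ _ (@cvg_snd _ _ (nbhs z) (nbhs y) _)
    (@proj_continuous _ _ (nth (Ordinal ltij) (enum 'I_j) i) y)).
exists g; split=> // z y Az; rewrite gE//= /djet; congr (iter_dderiv _ _ _).
by rewrite /vs -map_comp codomE.
Qed.

End composition.

Theorem proposition1p17 (K : realType) (E F X Z : lcsType K)
    (A : set Z) (R : set X) (S : set E) (k l : smoothness)
    (regA : regular_subset A) (regR : regular_subset R)
    (regS : regular_subset S) (lcS : locally_convex_subset S)
    (gamma : A -> Cspace (add_smooth l k) S F) (eta : A -> Cspace l R E)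
    (gammaC : isC k gamma) (etaC : isC k eta)
    (etaS : forall (z : A) (x : R), S (eta z x))
    (kRX : kR_space K (R * X)%type) (kAZ : kR_space K (A * Z)%type) :
  exists zetaC : forall z : A,
      isC l (fun x : R => gamma z (SigSub (mem_set (etaS z x)))),
    isC k (fun z : A => toC (zetaC z)).
Proof.
pose ze := zeta regA regR regS lcS gammaC etaC etaS.
have zeE z : (ze z : R -> F) = fun x => gamma z (SigSub (mem_set (etaS z x))).
  by apply/funext => x; exact: zetaE.
have zetaC z : isC l (fun x : R => gamma z (SigSub (mem_set (etaS z x)))).
  by rewrite -zeE; exact: CspaceP.
exists zetaC.
have -> : (fun z => toC (zetaC z)) = ze.
  by apply/funext => z; apply: val_inj; rewrite /= -zeE.
exact: zeta_isC.
Qed.
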